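(* Let $n\ge1$ and let $\sigma$ be a compactly supported probability measure on $G_n$. (i) If $1\le p<\infty$ and $\rho_p(\sigma)<1$, then $\widetilde M_\sigma$ is bounded on $L^p(G_n)$, that is, there is a constant $C$ with $\|\widetilde M_\sigma f\|_{L^p(G_n)}\le C\|f\|_{L^p(G_n)}$ for all $f\in L^p(G_n)$. (ii) If $\rho_1(\sigma)>1$, then $\widetilde M_\sigma$ is not bounded on $L^1(G_n)$ and is not of weak type $(1,1)$; that is, there is no constant $C$ with $\|\widetilde M_\sigma f\|_{L^1(G_n)}\le C\|f\|_{L^1(G_n)}$ for all $f\in L^1(G_n)$, and there is no constant $C$ with $\mu\{\widetilde M_\sigma f>\lambda\}\le\frac C\lambda\|f\|_{L^1(G_n)}$ for all $f\in L^1(G_n)$ and $\lambda>0$.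
   Context: $G_n=\mathbb R^n\rtimes\mathbb R_+$ is the set $\mathbb R^n\times(0,\infty)$ with group law $(x,y)(x',y')=(x+yx',yy')$, equipped with the left Haar measure $d\mu(x,y)=\frac{dx\,dy}{y^{n+1}}$; $L^p(G_n)$ is taken with respect to $\mu$. For $h=(a,b)\in G_n$ write $y(h)=b$. For a compactly supported (Borel) probability measure $\sigma$ on $G_n$ define $$R_\sigma f(g)=\int_{G_n}f(gh)\,d\sigma(h),\qquad \widetilde M_\sigma f(g)=\sup_{N\ge1}\frac1N\sum_{k=1}^N|R_\sigma^kf(g)|,$$ where $R_\sigma^k$ is the $k$-th iterate of $R_\sigma$, and for $1\le p<\infty$ $$\rho_p(\sigma)=\int_{G_n}y(h)^{n/p}\,d\sigma(h).$$ *)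

(* Defs.v *)
From HB Require Import structures.
From mathcomp Require Import all_boot all_order all_algebra.
From mathcomp Require Import all_classical all_reals all_analysis.
From mathcomp Require Import measurable_realfun.

Set Implicit Arguments.
Unset Strict Implicit.
Unset Printing Implicit Defensive.

Import Order.TTheory GRing.Theory Num.Theory.
Import numFieldNormedType.Exports.

Local Open Scope classical_set_scope.
Local Open Scope ring_scope.

Definition rV_display : measure_display.
Proof. exact: default_measure_display. Qed.

Section measurable_rV.
Context (R : realType) (n : nat).

Let coord (i : 'I_n) (x : 'rV[R]_n) : R := x ord0 i.

Let rV_set0 : g_sigma_preimage coord set0.
Proof. exact: sigma_algebra0. Qed.

Let rV_setC A : g_sigma_preimage coord A -> g_sigma_preimage coord (~` A).
Proof. exact: sigma_algebraC. Qed.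

Let rV_bigcup (F : _^nat) : (forall i, g_sigma_preimage coord (F i)) ->
  g_sigma_preimage coord (\bigcup_i (F i)).
Proof. exact: sigma_algebra_bigcup. Qed.

(* Generated by the coordinates. Open subsets of R^n x R are measurable for the
   resulting product sigma-algebra (open_measurable_rVR), so it is the Borel
   one. *)
HB.instance Definition _ := @isMeasurable.Build rV_display
  'rV[R]_n (g_sigma_preimage coord) rV_set0 rV_setC rV_bigcup.

Lemma measurable_coord (i : 'I_n) :
  measurable_fun [set: 'rV[R]_n] (fun x : 'rV[R]_n => x ord0 i).
Proof.
move=> _ Y mY; rewrite setTI; apply: sub_sigma_algebra => /=.
rewrite -bigcup_seq/=; exists i => /=; first by rewrite mem_index_enum.
by exists Y => //; rewrite setTI.
Qed.

Lemma measurable_fun_rV d (T : measurableType d) (f : T -> 'rV[R]_n) :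
  (forall i, measurable_fun [set: T] (fun t => f t ord0 i)) ->
  measurable_fun [set: T] f.
Proof.
move=> mf; suff H : g_sigma_preimage (fun i => coord i \o f) `<=` measurable.
  by rewrite g_sigma_preimage_comp in H; move=> _ A mA; apply: H; exists A.
apply: smallest_sub; first exact: sigma_algebra_measurable.
rewrite -bigcup_seq/=; apply: bigcup_sub => i _ A [B mB <-].
exact: mf.
Qed.

End measurable_rV.

Section lebesgue_rV.
Context (R : realType).

Definition rV_cons n (z : measurableTypeR R * 'rV[R]_n) : 'rV[R]_n.+1 :=
  row_mx (z.1 : R)%:M z.2.

Lemma rV_cons0 n z : @rV_cons n z ord0 ord0 = z.1.
Proof.
transitivity (rV_cons z ord0 (lshift n (ord0 : 'I_1))).
  by congr (rV_cons z ord0 _); exact: val_inj.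
by apply: (etrans (row_mxEl _ _ _ _)); rewrite mxE eqxx.
Qed.

Lemma rV_consS n z j : @rV_cons n z ord0 (lift ord0 j) = z.2 ord0 j.
Proof.
transitivity (rV_cons z ord0 (rshift 1 j)).
  by congr (rV_cons z ord0 _); exact: val_inj.
exact: row_mxEr.
Qed.

Lemma measurable_rV_cons n : measurable_fun setT (@rV_cons n).
Proof.
apply: measurable_fun_rV => i.
case: (unliftP ord0 i) => [j|] ->.
- apply: (eq_measurable_fun ((fun x : 'rV[R]_n => x ord0 j) \o snd)).
    by move=> z _; rewrite rV_consS.
  by apply: measurableT_comp => //; exact: measurable_coord.
- apply: (eq_measurable_fun (fst : measurableTypeR R * 'rV[R]_n -> R)).
    by move=> z _; rewrite rV_cons0.
  exact: measurable_fst.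
Qed.

Section step.
Context n (m : {sigma_finite_measure set 'rV[R]_n -> \bar R}).

Definition lebesgue_rV_step : set 'rV[R]_n.+1 -> \bar R :=
  pushforward (lebesgue_measure \x m)%E (@rV_cons n).

Let step0 : lebesgue_rV_step set0 = 0%E.
Proof. by rewrite /lebesgue_rV_step /pushforward preimage_set0 measure0. Qed.

Let step_ge0 A : (0 <= lebesgue_rV_step A)%E.
Proof. by rewrite /lebesgue_rV_step /pushforward; exact: measure_ge0. Qed.

Let step_sigma_additive : semi_sigma_additive lebesgue_rV_step.
Proof.
move=> F mF tF mUF; rewrite /lebesgue_rV_step /pushforward preimage_bigcup.
have mc := @measurable_rV_cons n.
apply: measure_semi_sigma_additive.
- by move=> i; rewrite -[X in measurable X]setTI; exact: mc.
- apply/trivIsetP => /= i j _ _ ij; rewrite -preimage_setI.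
  by move/trivIsetP : tF => /(_ _ _ _ _ ij) ->//; rewrite preimage_set0.
- by rewrite -preimage_bigcup -[X in measurable X]setTI; exact: mc.
Qed.

HB.instance Definition _ := isMeasure.Build _ _ _ lebesgue_rV_step
  step0 step_ge0 step_sigma_additive.

Let hd (x : 'rV[R]_n.+1) : measurableTypeR R := x ord0 ord0.
Let tl (x : 'rV[R]_n.+1) : 'rV[R]_n := \row_j x ord0 (lift ord0 j).

Let step_sigma_finite : sigma_finite setT lebesgue_rV_step.
Proof.
have /sigma_finiteP[F [FT ndF Ffin]] := sigma_finiteT (@lebesgue_measure R).
have /sigma_finiteP[G [GT ndG Gfin]] := sigma_finiteT m.
have mht : measurable_fun setT (fun x => (hd x, tl x)).
  apply/measurable_fun_pair; first exact: (@measurable_coord R n.+1 ord0).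
  apply: measurable_fun_rV => j.
  apply: (eq_measurable_fun (fun x : 'rV[R]_n.+1 => x ord0 (lift ord0 j))).
    by move=> x _; rewrite mxE.
  exact: measurable_coord.
pose H k := (fun x => (hd x, tl x)) @^-1` (F k `*` G k).
have mH k : measurable (H k).
  have [[mF _] [mG _]] := (Ffin k, Gfin k).
  by rewrite -[X in measurable X]setTI; apply: mht => //; exact: measurableX.
exists H; last first.
  move=> k; split; first exact: mH.
  have [[mF fF] [mG fG]] := (Ffin k, Gfin k).
  rewrite /lebesgue_rV_step /pushforward (_ : _ @^-1` _ = F k `*` G k).
    by rewrite product_measure1E// lte_mul_pinfty// ge0_fin_numE.
  rewrite /H -comp_preimage (_ : _ \o _ = id)//; apply/funext => -[a x]/=.
  by congr pair; [exact: rV_cons0|apply/rowP => j; rewrite mxE rV_consS].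
apply/esym; rewrite -subTset => x _.
have [i _ Fi] : (\bigcup_i F i) (hd x) by rewrite -FT.
have [j _ Gj] : (\bigcup_i G i) (tl x) by rewrite -GT.
exists (maxn i j) => //; split => /=.
- by move: Fi; exact/subsetPset/ndF/leq_maxl.
- by move: Gj; exact/subsetPset/ndG/leq_maxr.
Qed.

HB.instance Definition _ := Measure_isSigmaFinite.Build _ _ _ lebesgue_rV_step
  step_sigma_finite.

End step.

Section base.

Let base_sigma_finite : sigma_finite setT (\d_(0 : 'rV[R]_0) : set _ -> \bar R).
Proof.
exists (fun=> setT); first by rewrite bigcup_const//; exists 0%N.
by move=> _; split => //; rewrite diracT ltry.
Qed.

Definition dirac_rV0 : set 'rV[R]_0 -> \bar R := \d_(0 : 'rV[R]_0).
HB.instance Definition _ := Measure.on dirac_rV0.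
HB.instance Definition _ := Measure_isSigmaFinite.Build _ _ _ dirac_rV0
  base_sigma_finite.

End base.

Fixpoint lebesgue_rV n : {sigma_finite_measure set 'rV[R]_n -> \bar R} :=
  match n with
  | 0%N => dirac_rV0
  | n'.+1 => lebesgue_rV_step (lebesgue_rV n')
  end.

Lemma lebesgue_rV_box n (A : 'I_n -> set (measurableTypeR R)) :
  (forall i, measurable (A i)) ->
  lebesgue_rV n [set x | forall i, A i (x ord0 i)] =
  (\prod_(i < n) lebesgue_measure (A i))%E.
Proof.
elim: n A => [|n IH] A mA /=.
  rewrite big_ord0 /dirac_rV0 /= diracE mem_set//= => -[]//.
rewrite big_ord_recl -IH; last by move=> i; exact: mA.
have mA' : measurable
    [set x : 'rV[R]_n | forall i, A (lift ord0 i) (x ord0 i)].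
  have -> : [set x : 'rV[R]_n | forall i, A (lift ord0 i) (x ord0 i)] =
      \bigcap_(i in [set: 'I_n])
        ((fun x : 'rV[R]_n => x ord0 i) @^-1` A (lift ord0 i)).
    by apply/seteqP; split => [x /= H i _|x /= H i]; [exact: H|exact: (H i I)].
  apply: fin_bigcap_measurable => // i _.
  by rewrite -[X in measurable X]setTI; apply: measurable_coord => //; exact: mA.
rewrite -product_measure1E//.
rewrite /lebesgue_rV_step /pushforward; congr (_ _).
apply/seteqP; split => -[a x] /=.
- by move=> H; split => [|i]; [have := H ord0; rewrite rV_cons0
    |have := H (lift ord0 i); rewrite rV_consS].
- move=> [Ha Hx] i; case: (unliftP ord0 i) => [j|] ->.
    by rewrite rV_consS; exact: Hx.
  by rewrite rV_cons0.
Qed.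

End lebesgue_rV.

Section upper_half_space.
Context (R : realType) (n : nat).

Record Gn := MkGn { Gx : 'rV[R]_n ; Gy : R ; Gy_gt0 : 0 < Gy }.

Definition Gn_val (g : Gn) : 'rV[R]_n * measurableTypeR R := (Gx g, Gy g).

HB.instance Definition _ := gen_eqMixin Gn.
HB.instance Definition _ := gen_choiceMixin Gn.
HB.instance Definition _ := isPointed.Build Gn (MkGn 0 ltr01).
HB.instance Definition _ :=
  Topological.copy Gn (initial_topology (Gn_val : Gn -> 'rV[R]_n * R)).

Definition Gn_display : measure_display.
Proof. exact: default_measure_display. Qed.

HB.instance Definition _ := @isMeasurable.Build Gn_display Gn
  <<s [set U : set Gn | open U] >> (@sigma_algebra0 _ _ _)
  (@sigma_algebraC _ _) (@sigma_algebra_bigcup _ _ _).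

Lemma open_measurable_rVR (U : set ('rV[R]_n * R)) : open U ->
  measurable (U : set ('rV[R]_n * measurableTypeR R)).
Proof.
move=> oU.
pose B (c : ('rV[rat]_n * rat) * nat) : set ('rV[R]_n * measurableTypeR R) :=
  [set z : 'rV[R]_n * measurableTypeR R |
    (forall i, `|z.1 ord0 i - ratr (c.1.1 ord0 i)| < c.2.+1%:R^-1) /\
    `|(z.2 : R) - ratr c.1.2| < c.2.+1%:R^-1].
have mB c : measurable (B c).
  rewrite (_ : B c =
    ((\bigcap_(i in [set: 'I_n]) ((fun x : 'rV[R]_n => x ord0 i) @^-1`
      ball (ratr (c.1.1 ord0 i) : R) c.2.+1%:R^-1))
     `*` (ball (ratr c.1.2 : R) c.2.+1%:R^-1)))%classic.
    apply: measurableX; last by apply: open_measurable; exact: ball_open.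
    apply: fin_bigcap_measurable => // i _.
    rewrite -[X in measurable X]setTI; apply: measurable_coord => //.
    by apply: open_measurable; exact: ball_open.
  apply/seteqP; split => [[x y] [/= Bx By]|[x y] [/= Bx By]]; split => /=.
  - by move=> i _ /=; rewrite -ball_normE /= distrC.
  - by rewrite -ball_normE /= distrC.
  - by move=> i; rewrite distrC; have := Bx i I; rewrite /= -ball_normE.
  - by rewrite distrC; move: By; rewrite -ball_normE.
rewrite (_ : U = \bigcup_(c in [set c | B c `<=` U]) B c)%classic; last first.
  apply/seteqP; split => [z Uz|z [c /= BU Bz]]; last exact: BU.
  have : nbhs z U by rewrite nbhsE; exists U.
  move/nbhs_ballP => [e /= e0 eU].
  have [k ke] : exists k : nat, (k.+1%:R^-1 : R) < e / 2.
    have [k _ hk] := near_infty_natSinv_lt (PosNum (divr_gt0 e0 (ltr0Sn R 1))).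
    by exists k; apply: (hk k) => /=.
  have ex (x : R) : exists q : rat, `|x - ratr q| < k.+1%:R^-1.
    have : x - k.+1%:R^-1 < x + k.+1%:R^-1.
      by rewrite ltrD2l gtrN// invr_gt0.
    by case/rat_in_itvoo => q /itvP qq; exists q; rewrite ltr_distlC !qq.
  pose q (x : R) := projT1 (cid (ex x)).
  have qP x : `|x - ratr (q x)| < k.+1%:R^-1 by rewrite /q; case: cid.
  exists ((\row_i q (z.1 ord0 i), q z.2), k); last first.
    by split => /= [i|]; rewrite ?mxE; exact: qP.
  move=> w [/= w1 w2]; apply: eU.
  have tri (a b c : R) : `|a - c| < k.+1%:R^-1 -> `|b - c| < k.+1%:R^-1 ->
      ball b e a.
    move=> ac bc; rewrite -ball_normE /=.
    rewrite (_ : b - a = (b - c) - (a - c)); last by rewrite opprB addrA subrK.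
    rewrite (le_lt_trans (ler_normB _ _))//.
    by rewrite (splitr e) ltrD// (lt_trans _ ke).
  split => /=; last exact: tri w2 (qP _).
  split => // i j; rewrite (ord1 i).
  by apply: (tri _ _ (ratr (q (z.1 ord0 j)))) (qP _); have := w1 j; rewrite mxE.
rewrite bigcup_mkcond; apply: countable_bigcupT_measurable => // c.
by case: ifP.
Qed.

Let half_space_measurable :
  measurable [set z : 'rV[R]_n * measurableTypeR R | 0 < (z.2 : R)].
Proof.
rewrite (_ : mkset _ = setT `*` [set` `]0, +oo[%R]); last first.
  by apply/seteqP; split => -[x y] /=; rewrite in_itv /= andbT => // -[].
by apply: measurableX => //; exact: measurable_itv.
Qed.

Lemma Gn_val_inj : injective Gn_val.
Proof.
move=> [x y y0] [x' y' y0'] [xx yy]; case: _ / xx; move: y0'; case: _ / yy => y0'.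
by congr MkGn; exact: bool_irrelevance.
Qed.

Lemma image_Gn_valT :
  Gn_val @` setT = [set z : 'rV[R]_n * measurableTypeR R | 0 < (z.2 : R)].
Proof.
apply/seteqP; split => [_ [g _ <-]|[x y] /= y0]; first exact: Gy_gt0.
by exists (MkGn x y0).
Qed.

Lemma measurable_image_Gn_val (A : set Gn) : measurable A ->
  measurable (Gn_val @` A).
Proof.
move: A; apply: smallest_sub => [|U [V oV <-]]; last first.
  rewrite (_ : _ @` _ =
      (V : set (_ * measurableTypeR R)) `&` (Gn_val @` setT)).
    rewrite image_Gn_valT; apply: measurableI => //.
    exact: open_measurable_rVR.
  apply/seteqP; split => [_ [g /= Vg <-]|_ [/[swap] -[g _ <-] Vg]].
    by split => //; exists g.
  by exists g.
split => [|A /= mA|F /= mF]; first by rewrite image_set0.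
- rewrite (_ : _ @` _ = (Gn_val @` setT) `\` (Gn_val @` A)).
    by apply: measurableD => //; rewrite image_Gn_valT.
  apply/seteqP; split => [_ [g [_ nAg] <-]|_ [[g _ <-] nA]].
    by split; [exists g|move=> [h Ah /Gn_val_inj hg]; apply: nAg; rewrite -hg].
  by exists g => //; split => // Ag; apply: nA; exists g.
- by rewrite image_bigcup; exact: bigcupT_measurable.
Qed.

(* dx dy / y^(n+1) on R^n x ]0, +oo[. *)
Definition haar (A : set Gn) : \bar R :=
  (\int[lebesgue_rV R n \x lebesgue_measure]_(z in Gn_val @` A)
     ((z.2 : R) ^- n.+1)%:E)%E.

Let density_measurable : measurable_fun (Gn_val @` setT)
  (fun z : 'rV[R]_n * measurableTypeR R => ((z.2 : R) ^- n.+1)%:E).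
Proof.
rewrite image_Gn_valT; apply/measurable_EFinP.
apply: (@measurable_comp _ _ _ _ _ _ [set y : measurableTypeR R | 0 < (y : R)]
  (fun y : measurableTypeR R => ((y : R) ^- n.+1) : R) _ snd).
- rewrite (_ : mkset _ = [set` `]0, +oo[%R]); first exact: measurable_itv.
  by apply/seteqP; split => y /=; rewrite in_itv /= andbT.
- by move=> _ [z /= z0 <-].
- apply: (@open_continuous_measurable_fun R [set y : R | 0 < y]).
    exact: open_gt.
  move=> y; rewrite inE /= => y0; apply: cvgV; last exact: exprn_continuous.
  by rewrite expf_neq0// gt_eqF.
- exact: measurable_funTS.
Qed.

Let haar0 : haar set0 = 0%E.
Proof. by rewrite /haar image_set0 integral_set0. Qed.

Let haar_ge0 A : (0 <= haar A)%E.
Proof.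
apply: integral_ge0 => _ [g _ <-].
by rewrite lee_fin invr_ge0 exprn_ge0// ltW// Gy_gt0.
Qed.

Let haar_sigma_additive : semi_sigma_additive haar.
Proof.
move=> F mF tF mUF; rewrite /haar image_bigcup ge0_integral_bigcup//=.
- by apply: is_cvg_ereal_nneg_natsum_cond => // k _ _; exact: haar_ge0.
- by move=> k; exact: measurable_image_Gn_val.
- apply: measurable_funS density_measurable.
    by rewrite image_Gn_valT.
  by move=> _ [k _ [g _ <-]]; exists g.
- move=> _ [k _ [g _ <-]].
  by rewrite lee_fin invr_ge0 exprn_ge0// ltW// Gy_gt0.
- apply/trivIsetP => i j _ _ ij; move/trivIsetP : tF => /(_ _ _ I I ij) Fij.
  rewrite -subset0 => _ [[g Fg <-] [h Fh /Gn_val_inj hg]].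
  by have : (F i `&` F j) g; [split => //; rewrite -hg|rewrite Fij].
Qed.

HB.instance Definition _ := isMeasure.Build _ _ _ haar
  haar0 haar_ge0 haar_sigma_additive.

End upper_half_space.

Arguments haar : clear implicits.

Section random_walk.
Context (R : realType) (n : nat).
Local Notation G := (Gn R n).

Definition Gn_mul (g h : G) : G :=
  MkGn (Gx g + Gy g *: Gx h) (mulr_gt0 (Gy_gt0 g) (Gy_gt0 h)).

Context (sigma : probability G R).

Definition compactly_supported : Prop :=
  exists K : set G, compact K /\ sigma (~` K) = 0%E.

Definition rho (p : R) : \bar R := (\int[sigma]_h (Gy h `^ (n%:R / p))%:E)%E.

(* For f in L^p the integral converges for almost every g only, hence the
   extended real values; they also let R_op be iterated as a total operator. *)
Definition R_op (f : G -> \bar R) : G -> \bar R :=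
  fun g => (\int[sigma]_h f (Gn_mul g h))%E.

Definition M_op (f : G -> \bar R) : G -> \bar R := fun g =>
  ereal_sup [set (N%:R^-1)%:E *
                 (\sum_(1 <= k < N.+1) `|iter k R_op f g|)%E
            | N in [set N : nat | (1 <= N)%N]]%E.

End random_walk.

(* Main.v *)
Require Import Defs.
From HB Require Import structures.
From mathcomp Require Import all_boot all_order all_algebra.
From mathcomp Require Import all_classical all_reals all_analysis.
From mathcomp Require Import measurable_realfun lra ring.

(** Write [T] for the operator [R_op sigma] and [mu] for the Haar measure. The
    measure [mu] is left invariant, but right multiplication by [h] multiplies the
    mass of preimages by [Gy h ^+ n] ([haar_mulr]). All the rest follows from this
    modular factor.

    Boundedness. By Tonelli and a weighted Jensen inequality, [T] has norm at most
    [rho] on [L^p] ([integral_R_op_powR]). The maximal function is dominated by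
    the series of all the iterates [T^k |f|], so when [rho < 1] its norm is at most
    the sum of a geometric series, [1 / (1 - rho)] times the norm of [f]
    ([integral_series_powR]).

    Unboundedness at [p = 1]. On nonnegative functions Tonelli is an equality, and
    [T^N f] has integral [rho^N] times that of [f]. The maximal function is at
    least [T^N f / N], so a strong bound would make [rho^N / N] bounded, which is
    absurd for [rho > 1]. A weak type bound is refuted by the same growth: take for
    [f] the indicator of a box. Then [T^N f] takes its values in [0, 1], and since
    [sigma] has compact support, [T^N f] vanishes off a box whose Haar measure is
    at most exponential in [N] ([iter_R_op_support], [haar_box_le]). On a set of
    measure [e^(O(N))], a function bounded by [1] and of weak [L^1] size [O(N)]
    has integral [O(N^2)], since only [O(N)] dyadic levels matter
    ([dyadic_bound]); this contradicts the exponential growth of its integral. *)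

Set Implicit Arguments.
Unset Strict Implicit.
Unset Printing Implicit Defensive.

Import Order.TTheory GRing.Theory Num.Theory.
Import numFieldNormedType.Exports.

Local Open Scope classical_set_scope.
Local Open Scope ring_scope.
Local Open Scope ereal_scope.

(** * Integral inequalities *)

Section general.
Context d (T : measurableType d) (R : realType) (mu : {measure set T -> \bar R}).

(** The integral of a nonnegative function is a supremum over the simple
    functions below it, so it is monotone even without measurability. This
    spares the measurability of maximal functions below. *)
Lemma le_ge0_integral (D : set T) (f g : T -> \bar R) :
  (forall x, D x -> 0 <= f x) -> (forall x, D x -> f x <= g x) ->
  \int[mu]_(x in D) f x <= \int[mu]_(x in D) g x.
Proof.
move=> f0 fg.
have g0 x : D x -> 0 <= g x by move=> Dx; exact: le_trans (f0 _ Dx) (fg _ Dx).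
rewrite !ge0_integralE//; apply: ereal_sup_le => _ [h hf <-] /=.
exists h => // x /=; apply: le_trans (hf x) _.
exact: lee_restrict.
Qed.

(** Also free of measurability: both the positive and the negative part of [f]
    are below [`|f|], and by convention [+oo - +oo = -oo] has absolute value
    [+oo], which is then also the right-hand side. *)
Lemma abse_integral_le (f : T -> \bar R) :
  `|\int[mu]_x f x| <= \int[mu]_x `|f x|.
Proof.
rewrite integralE.
set a := integral _ _ _; set b := integral _ _ _; set c := integral _ _ _.
have a0 : 0 <= a by exact: integral_ge0.
have b0 : 0 <= b by exact: integral_ge0.
have ac : a <= c.
  apply: le_ge0_integral => // x _; rewrite funeposE ge_max abse_ge0 andbT.
  exact: lee_abs.
have bc : b <= c.
  apply: le_ge0_integral => // x _; rewrite funenegE ge_max abse_ge0 andbT.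
  by rewrite -abseN lee_abs.
move: a b c a0 b0 ac bc => [a| |] [b| |] [c| |] //=; rewrite ?leey// !lee_fin.
move=> a0 b0 ac bc; rewrite ler_norml; apply/andP; split; lra.
Qed.

End general.

(** The graph of the convex function [t `^ p] lies above its tangent at [s];
    this is Young's inequality for [t] and [s `^ (p - 1)]. *)
Lemma powR_tangent (R : realType) (p s t : R) : (1 <= p)%R -> (0 <= s)%R ->
  (0 <= t)%R ->
  (p * s `^ (p - 1) * t <= t `^ p + (p - 1) * s `^ p)%R.
Proof.
rewrite le_eqVlt => /predU1P[<-|p1] s0 t0.
  by rewrite subrr powRr0 mul0r addr0 powRr1// !mul1r.
have p0 : (0 < p)%R by rewrite (lt_trans _ p1).
have p10 : (0 < p - 1)%R by rewrite subr_gt0.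
have := @conjugate_powR R t (s `^ (p - 1))%R p (p / (p - 1))%R t0
  (powR_ge0 _ _) p0.
rewrite divr_gt0// invf_div => /(_ erefl).
rewrite -powRrM (_ : (p - 1) * (p / (p - 1)) = p)%R; last first.
  by rewrite mulrCA divff ?mulr1// gt_eqF.
have -> : (p^-1 + (p - 1) / p = 1)%R by field; rewrite gt_eqF.
move=> /(_ erefl); rewrite -(ler_pM2l p0) mulrDr => H.
rewrite -mulrA (mulrC (powR _ _)) (le_trans H)//.
rewrite mulrCA divff ?gt_eqF// mulr1 lerD2l mulrCA [(p * _)%R]mulrCA.
by rewrite divff ?gt_eqF// mulr1 mulrC.
Qed.

Section jensen.
Context d (T : measurableType d) (R : realType) (mu : {measure set T -> \bar R}).
Variables (p W : R) (w : T -> R) (u : T -> \bar R).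
Hypothesis p1 : (1 <= p)%R.
Hypothesis w0 : forall x, (0 < w x)%R.
Hypothesis mw : measurable_fun setT w.
Hypothesis W0 : (0 < W)%R.
Hypothesis intw : \int[mu]_x (w x)%:E = W%:E.
Hypothesis u0 : forall x, 0 <= u x.
Hypothesis mu_meas : measurable_fun setT u.

Let p0 : (0 < p)%R. Proof. exact: lt_le_trans p1. Qed.

Let tangent (s : R) x : (0 <= s)%R ->
  (p * s `^ (p - 1))%:E * u x <=
  ((w x) `^ (1 - p))%:E * u x `^ p + ((p - 1) * s `^ p)%:E * (w x)%:E.
Proof.
move=> s0; move: (u0 x); case: (u x) => [t|_|//]; last first.
  rewrite eqy_poweR//.
  rewrite [X in _ <= X + _]gt0_muley ?lte_fin ?powR_gt0//.
  by rewrite addye ?leey// -EFinM.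
rewrite lee_fin => t0; rewrite poweR_EFin -!EFinM -EFinD lee_fin.
have tw : (0 <= t / w x)%R by rewrite divr_ge0// ltW.
have /(ler_wpM2r (ltW (w0 x))) := powR_tangent p1 s0 tw.
rewrite -[X in (X <= _)%R]mulrA divfK ?gt_eqF//.
move=> /le_trans; apply; rewrite mulrDl lerD2r.
have w1 : (0 <= w x)%R by exact: ltW.
rewrite powRM ?invr_ge0// -powR_inv1// -powRrM mulN1r -mulrA mulrC.
rewrite -[X in (_ * X * _)%R](powRr1 w1) -powRD; last first.
  by rewrite (gt_eqF (w0 x)) implybT.
by rewrite addrC.
Qed.

(** Jensen's inequality for the probability [w / W] and the function [u / w],
    with [u] allowed to be infinite. Integrate the tangent inequality for
    [t = u / w] against [w], then take for [s] the mean [(\int u) / W], the point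
    at which the tangent bound is sharp. *)
Lemma weighted_jensen :
  (\int[mu]_x u x) `^ p <=
  (W `^ (p - 1))%:E * \int[mu]_x (((w x) `^ (1 - p))%:E * u x `^ p).
Proof.
set I := integral _ _ (fun x => _ * _).
have mwp : measurable_fun setT (fun x => (w x `^ (1 - p))%R).
  exact: (@measurableT_comp _ _ _ _ _ _ (@powR R ^~ (1 - p)%R)).
have mint : measurable_fun setT (fun x => ((w x) `^ (1 - p))%:E * u x `^ p).
  apply: emeasurable_funM; first exact/measurable_EFinP.
  exact: (measurableT_comp (measurable_poweR _)).
have I0 : 0 <= I.
  by apply: integral_ge0 => x _; rewrite mule_ge0 ?poweR_ge0// lee_fin powR_ge0.
have key (s : R) : (0 <= s)%R -> (p * s `^ (p - 1))%:E * \int[mu]_x u x <=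
    I + ((p - 1) * s `^ p)%:E * W%:E.
  move=> s0; have k1 : (0 <= p * s `^ (p - 1))%R by rewrite mulr_ge0 ?powR_ge0// ltW.
  have k2 : (0 <= (p - 1) * s `^ p)%R by rewrite mulr_ge0 ?powR_ge0// subr_ge0.
  rewrite -ge0_integralZl_EFin// -intw -ge0_integralZl_EFin//; last 2 first.
  - by move=> x _; rewrite lee_fin ltW.
  - exact/measurable_EFinP.
  rewrite -ge0_integralD//.
  - apply: le_ge0_integral => x _; last exact: tangent.
    by rewrite mule_ge0.
  - by move=> x _; rewrite mule_ge0 ?poweR_ge0// lee_fin powR_ge0.
  - by move=> x _; rewrite -EFinM lee_fin mulr_ge0 // ltW.
  - apply: measurable_funeM; exact/measurable_EFinP.
have U0 : 0 <= \int[mu]_x u x by exact: integral_ge0.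
move: I0 key; case: I => [i|_ _|//]; last first.
  by rewrite gt0_muley ?leey// lte_fin powR_gt0.
rewrite lee_fin => i0 key; move: U0 key.
case: (integral _ _ _) => [v||//]; last first.
  (* any [s > 0] shows that [u] is integrable when the right-hand side is finite *)
  move=> _ /(_ 1%R ler01); rewrite gt0_muley ?leye_eq// lte_fin.
  by rewrite mulr_gt0// powR_gt0.
rewrite lee_fin => v0 key.
have [r r0 vE] : exists2 r, (0 <= r)%R & v = (r * W)%R.
  by exists (v / W)%R; rewrite ?divfK ?divr_ge0 ?(ltW W0)// gt_eqF.
have := key _ r0.
rewrite {}vE poweR_EFin -!EFinM -EFinD !lee_fin.
rewrite powRM ?r0 ?(ltW W0)//.
rewrite -(mulr_powRB1 (ltW W0) p0) -(mulr_powRB1 r0 p0).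
set x := powR r _; set y := powR W _ => H.
have y0 : (0 <= y)%R by exact: powR_ge0.
have : (r * x * W <= i)%R by lra.
by move=> /(ler_wpM2l y0); apply: le_trans; rewrite [leRHS]mulrC !mulrA.
Qed.

End jensen.

(** A bounded function is controlled by its dyadic level sets, up to the error
    [2^-J]. The induction step only has to look at level [J]: either [t] is above
    [2^-(J+1)], which pays for halving the error, or it is below the new error. *)
Lemma dyadic_bound (R : realType) (t : R) (J : nat) : (t <= 1)%R ->
  (t <= \sum_(j < J) 2^-1 ^+ j * (2^-1 ^+ j.+1 < t)%R%:R + 2^-1 ^+ J)%R.
Proof.
move=> t1; elim: J => [|J IH]; first by rewrite big_ord0 add0r expr0.
rewrite big_ord_recr/=; case: ltP => [_|tJ].
  by rewrite mulr1 (le_trans IH)// lerDl exprn_ge0.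
rewrite mulr0 addr0 (le_trans tJ)// lerDr sumr_ge0//.
Qed.

(** * Invariance properties of Lebesgue measure *)

(** [pushforward m f] is a measure only because [f] is measurable; carrying that
    proof as an argument makes the structure inferable. *)
Definition image_measure d d' (T : measurableType d) (T' : measurableType d')
    (R : realType) (m : {measure set T -> \bar R}) (f : T -> T')
    (mf : measurable_fun setT f) : {measure set T' -> \bar R} :=
  measure_function_pushforward__canonical__measure_function_Measure m mf.

Section lebesgue.
Context (R : realType).

Lemma measurable_affine (a b : R) :
  measurable_fun setT
    (fun y : measurableTypeR R => (a + b * y)%R : measurableTypeR R).
Proof. by apply: measurable_funD => //; exact: mulrl_measurable. Qed.

Lemma lebesgue_measure_affine (a b : R) (b0 : (0 < b)%R)
    (A : set (measurableTypeR R)) : measurable A ->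
  lebesgue_measure ((fun y : measurableTypeR R => (a + b * y)%R) @^-1` A) =
  (b^-1)%:E * lebesgue_measure A.
Proof.
move=> mA.
pose f (y : measurableTypeR R) : measurableTypeR R := (a + b * y)%R.
have mf : measurable_fun setT f by exact: measurable_affine.
pose b' := NngNum (ltW b0).
have H : lebesgue_measure A =
    mscale b' (image_measure lebesgue_measure mf) A.
  apply: lebesgue_measure_unique => // _ [[c d] _ <-].
  change (lebesgue_measure `]c, d]%classic =
    b%:E * lebesgue_measure (f @^-1` `]c, d]%classic)).
  have -> : f @^-1` [set` `]c, d]%R] = [set` `]((c - a) / b)%R, ((d - a) / b)%R]%R].
    apply/seteqP; split => y; rewrite /= !in_itv/= /f ltr_pdivrMr// ler_pdivlMr//.
      by rewrite ltrBlDl lerBrDl mulrC.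
    by rewrite ltrBlDl lerBrDl mulrC.
  rewrite !lebesgue_measure_itv/= !lte_fin.
  rewrite ltr_pM2r ?invr_gt0// ltrD2r; case: ifPn => _; last by rewrite mule0.
  rewrite -!EFinB -EFinM; congr EFin; field.
  by rewrite gt_eqF.
rewrite [in RHS]H.
change (lebesgue_measure (f @^-1` A) =
  (b^-1)%:E * (b%:E * lebesgue_measure (f @^-1` A))).
by rewrite muleA -EFinM mulVf ?gt_eqF// mul1e.
Qed.


Lemma measurable_rV_shift n (v : 'rV[R]_n) :
  measurable_fun setT (fun x : 'rV[R]_n => (x + v)%R).
Proof.
apply: measurable_fun_rV => i.
apply: (eq_measurable_fun (fun x : 'rV[R]_n => (x ord0 i + v ord0 i)%R)).
  by move=> x _; rewrite mxE.
by apply: measurable_funD => //; exact: measurable_coord.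
Qed.

(** By induction on the dimension: a translation of [R^(n+1)] is the product of a
    translation of [R] and one of [R^n], and a measure on a product is determined
    by its values on rectangles. *)
Lemma lebesgue_rV_shift n (v : 'rV[R]_n) (A : set 'rV[R]_n) : measurable A ->
  lebesgue_rV R n ((fun x => x + v)%R @^-1` A) = lebesgue_rV R n A.
Proof.
elim: n v A => [|n IH] v A mA.
  congr (lebesgue_rV R 0 _); apply/seteqP.
  by split => x /=; rewrite (thinmx0 v) addr0.
pose v0 : measurableTypeR R := v ord0 ord0.
pose v' : 'rV[R]_n := (\row_j v ord0 (lift ord0 j))%R.
pose t (z : measurableTypeR R * 'rV[R]_n) : measurableTypeR R * 'rV[R]_n :=
  ((v0 + 1 * z.1)%R, (z.2 + v')%R).
have mt : measurable_fun setT t.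
  apply/measurable_fun_pair.
    exact: (measurableT_comp (measurable_affine v0 1%R) measurable_fst).
  exact: (measurableT_comp (measurable_rV_shift v') measurable_snd).
pose B := (@rV_cons R n) @^-1` A.
have mB : measurable B.
  by rewrite -[X in measurable X]setTI; exact: measurable_rV_cons.
have consE z : (rV_cons z + v)%R = rV_cons (t z).
  apply/rowP => i; rewrite mxE; case: (unliftP ord0 i) => [j|] ->.
    by rewrite !rV_consS /= !mxE.
  by rewrite !rV_cons0 /= mul1r addrC.
change ((lebesgue_measure \x lebesgue_rV R n)
  ((fun z => rV_cons z + v)%R @^-1` A) = (lebesgue_measure \x lebesgue_rV R n) B).
have -> : (fun z => rV_cons z + v)%R @^-1` A = t @^-1` B.
  by apply/seteqP; split => z; rewrite /B /= consE.
apply/esym.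
change ((lebesgue_measure \x lebesgue_rV R n) B =
  image_measure (lebesgue_measure \x lebesgue_rV R n) mt B).
apply: product_measure_unique => // A1 A2 mA1 mA2.
change ((lebesgue_measure \x lebesgue_rV R n) (t @^-1` (A1 `*` A2)) =
  lebesgue_measure A1 * lebesgue_rV R n A2).
rewrite -(IH v' A2)// -[lebesgue_measure A1]mul1e -[X in X%:E]invr1.
rewrite -(lebesgue_measure_affine v0 ltr01)// -product_measure1E//.
- by rewrite -[X in measurable X]setTI; exact: measurable_affine.
- by rewrite -[X in measurable X]setTI; exact: measurable_rV_shift.
Qed.


Section product_affine.
Context (n : nat).
Local Notation X := ('rV[R]_n * measurableTypeR R)%type.
Local Notation leb := (lebesgue_rV R n \x lebesgue_measure).

(** Right multiplication by [(a, b)] on [R^n * R]. Its second coordinate is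
    written as a member of the family [y |-> a + b * y]. *)
Definition right_mul (a : 'rV[R]_n) (b : R) (z : X) : X :=
  (z.1 + (z.2 : R) *: a, 0 + b * z.2)%R.

Lemma measurable_right_mul a b : measurable_fun setT (right_mul a b).
Proof.
apply/measurable_fun_pair.
  apply: measurable_fun_rV => i.
  apply: (eq_measurable_fun
    (fun z : X => (z.1 ord0 i + (z.2 : R) * a ord0 i)%R)).
    by move=> z _; rewrite !mxE.
  apply: measurable_funD.
    exact: (measurableT_comp (measurable_coord i) measurable_fst).
  by apply: measurable_funM => //; exact: measurable_snd.
exact: (measurableT_comp (measurable_affine 0%R b) measurable_snd).
Qed.

(** Slice by the last coordinate. At height [y] the preimage is a translate of the
    slice of [B] at height [b * y]; translations preserve the volume of the slice,
    and the dilation of the last coordinate contributes [b^-1]. *)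
Lemma lebesgue_right_mul a b (b0 : (0 < b)%R) (B : set X) : measurable B ->
  leb (right_mul a b @^-1` B) = (b^-1)%:E * leb B.
Proof.
move=> mB.
have mrB : measurable (right_mul a b @^-1` B).
  by rewrite -[X in measurable X]setTI; exact: measurable_right_mul.
have E (C : set X) : measurable C -> leb C =
    \int[lebesgue_measure]_y lebesgue_rV R n (ysection C y).
  move=> mC; apply: (@product_measure_unique _ _ _ _ _ _ _
    [the {measure set X -> \bar R} of lebesgue_rV R n \x^ lebesgue_measure]) => //.
  by move=> A1 A2 mA1 mA2 /=; exact: product_measure2E.
rewrite !E//.
pose g y := lebesgue_rV R n (ysection B y).
have mg : measurable_fun setT g by exact: measurable_fun_ysection.
have g0 y : 0 <= g y by exact: measure_ge0.
transitivity (\int[lebesgue_measure]_y g (0 + b * y)%R).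
  apply: eq_integral => y _; rewrite /g.
  rewrite -[RHS](lebesgue_rV_shift ((y : R) *: a)); last exact: measurable_ysection.
  by rewrite !ysectionE.
transitivity (\int[image_measure lebesgue_measure (measurable_affine 0%R b)]_y g y).
  by rewrite ge0_integral_pushforward//; exact: measurable_affine.
have bV0 : (0 <= b^-1)%R by rewrite invr_ge0 ltW.
transitivity (\int[mscale (NngNum bV0) lebesgue_measure]_y g y).
  by apply: eq_measure_integral => A mA _; exact: lebesgue_measure_affine.
by rewrite ge0_integral_mscale.
Qed.

End product_affine.

End lebesgue.

(** * Measurability and Haar measure on the group *)

Section Gn_measurable.
Context (R : realType) (n : nat).
Local Notation G := (Gn R n).

Lemma Gy_continuous : continuous (@Gy R n).
Proof.
have c2 : continuous (@snd 'rV[R]_n R) by move=> x; exact: cvg_snd.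
apply/continuousP => A oA; exists (@snd 'rV[R]_n R @^-1` A) => //.
by move/continuousP : c2; exact.
Qed.

Lemma Gx_continuous : continuous (@Gx R n).
Proof.
have c1 : continuous (@fst 'rV[R]_n R) by move=> x; exact: cvg_fst.
apply/continuousP => A oA; exists (@fst 'rV[R]_n R @^-1` A) => //.
by move/continuousP : c1; exact.
Qed.

Lemma continuous_Gn_measurable (f : G -> R) :
  continuous f -> measurable_fun setT f.
Proof.
move=> /continuousP cf; apply: (measurability _ (RGenOpens.measurableE R)).
move=> _ [_ [a [b ->] <-]]; rewrite setTI; apply: sub_sigma_algebra.
exact/cf/interval_open.
Qed.

Lemma measurable_Gy : measurable_fun setT (@Gy R n).
Proof. apply: continuous_Gn_measurable. apply: Gy_continuous. Qed.

Lemma measurable_Gx : measurable_fun setT (@Gx R n).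
Proof.
apply: measurable_fun_rV => i; apply: continuous_Gn_measurable => g.
apply: (@continuous_comp _ _ _ (@Gx R n) (fun x : 'rV[R]_n => x ord0 i)).
  exact: Gx_continuous.
exact: coord_continuous.
Qed.

(** The Borel sets of the group are generated by the open sets of [R^n * R], which
    are already measurable for the product sigma-algebra. *)
Lemma measurable_to_Gn d (T : measurableType d) (f : T -> G) :
  measurable_fun setT (fun t => Gx (f t)) ->
  measurable_fun setT (fun t => Gy (f t)) ->
  measurable_fun setT f.
Proof.
move=> mx my; apply: (@measurability _ _ _ _ _ _ [set U : set G | open U]) => //.
move=> _ [_ [V oV <-] <-].
have mV := open_measurable_rVR oV.
have mf : measurable_fun setT (fun t => (Gx (f t), Gy (f t) : measurableTypeR R)).
  exact/measurable_fun_pair.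
exact: mf.
Qed.

Lemma measurable_Gn_mul :
  measurable_fun setT (fun z : G * G => Gn_mul z.1 z.2).
Proof.
have m1 := measurableT_comp measurable_Gy (@measurable_fst _ _ G G).
have m2 := measurableT_comp measurable_Gy (@measurable_snd _ _ G G).
apply: measurable_to_Gn => /=; last exact: measurable_funM.
apply: measurable_fun_rV => i.
apply: (eq_measurable_fun
    (fun z : G * G => (Gx z.1 ord0 i + Gy z.1 * Gx z.2 ord0 i)%R)).
  by move=> z _; rewrite !mxE.
have mx := measurableT_comp (measurable_coord i) measurable_Gx.
apply: measurable_funD; first exact: (measurableT_comp mx measurable_fst).
by apply: measurable_funM => //; exact: (measurableT_comp mx measurable_snd).
Qed.

Lemma measurable_mulr (h : G) : measurable_fun setT (fun g => Gn_mul g h).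
Proof. exact: (measurableT_comp measurable_Gn_mul (pair2_measurable h)). Qed.

Lemma measurable_mull (g : G) : measurable_fun setT (Gn_mul g).
Proof. exact: (measurableT_comp measurable_Gn_mul (pair1_measurable g)). Qed.

End Gn_measurable.

Section haar_measure.
Context (R : realType) (n : nat).
Local Notation G := (Gn R n).
Local Notation X := ('rV[R]_n * measurableTypeR R)%type.
Local Notation leb := (lebesgue_rV R n \x lebesgue_measure).

(** The density [y^-(n+1)] of the Haar measure, as a real power: this form is
    measurable on all of [R^n * R], not only where [y > 0]. *)
Definition density (z : X) : R := ((z.2 : R) `^ (- n.+1%:R))%R.

Lemma measurable_density : measurable_fun setT density.
Proof.
exact: (@measurableT_comp _ _ _ _ _ _ (@powR R ^~ (- n.+1%:R)%R)).
Qed.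

Lemma densityE (z : X) : (0 < (z.2 : R))%R -> density z = ((z.2 : R) ^- n.+1)%R.
Proof. by move=> z0; rewrite /density powRN powR_mulrn ?ltW. Qed.

Lemma density_ge0 z : (0 <= density z)%R. Proof. exact: powR_ge0. Qed.

Lemma image_Gn_val_gt0 (A : set G) (z : X) :
  (@Gn_val R n @` A) z -> (0 < (z.2 : R))%R.
Proof. by move=> [g _ <-]; exact: Gy_gt0. Qed.

Lemma haarE (A : set G) :
  haar R n A = \int[leb]_(z in @Gn_val R n @` A) (density z)%:E.
Proof.
apply: eq_integral => z; rewrite inE => Az; rewrite densityE//.
exact: image_Gn_val_gt0 Az.
Qed.

(** By monotonicity of the integral, for arbitrary sets. *)
Lemma le_haar (A B : set G) : A `<=` B -> haar R n A <= haar R n B.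
Proof.
move=> AB; rewrite !haarE integral_mkcond [leRHS]integral_mkcond.
apply: le_ge0_integral => z _.
  by apply: erestrict_ge0 => x _; rewrite lee_fin density_ge0.
rewrite /patch; case: ifPn => [|_].
  by rewrite inE => -[g /AB Bg <-]; rewrite mem_set//; exists g.
by case: ifPn => // _; rewrite lee_fin density_ge0.
Qed.

(** The modular function. With [h = (a, b)], taking preimages under right
    multiplication by [h] divides Lebesgue measure by [b], while the density at
    a point is [b^(n+1)] times the density at its image; in total the mass is
    multiplied by [b^(n+1) / b = b^n]. *)
Lemma haar_mulr (h : G) (A : set G) : measurable A ->
  haar R n ((fun g => Gn_mul g h) @^-1` A) = (Gy h ^+ n)%:E * haar R n A.
Proof.
move=> mA.
have b0 := Gy_gt0 h; set b := Gy h in b0 *; set a := Gx h.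
rewrite !haarE.
have mD : measurable (@Gn_val R n @` A) by exact: measurable_image_Gn_val.
have -> : @Gn_val R n @` ((fun g => Gn_mul g h) @^-1` A) =
    right_mul a b @^-1` (@Gn_val R n @` A).
  apply/seteqP; split => z /=.
    move=> [g Agh <-]; exists (Gn_mul g h) => //.
    by rewrite /Gn_val /right_mul /= add0r mulrC.
  move=> /[dup] [[g Ag gz]] /image_Gn_val_gt0 /=.
  rewrite add0r pmulr_rgt0// => z0.
  exists (MkGn z.1 z0); last by rewrite /Gn_val /= -surjective_pairing.
  suff -> : Gn_mul (MkGn z.1 z0) h = g by [].
  apply: Gn_val_inj; rewrite gz /Gn_val /right_mul /=.
  by rewrite add0r mulrC.
have md := measurable_density.
transitivity (\int[leb]_(z in right_mul a b @^-1` (@Gn_val R n @` A))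
    ((b ^+ n.+1)%:E * (EFin \o density) (right_mul a b z))).
  apply: eq_integral => z; rewrite inE /= => /image_Gn_val_gt0.
  rewrite /density /= -EFinM add0r => bz.
  have z0 : (0 < (z.2 : R))%R by rewrite -(pmulr_rgt0 _ b0).
  rewrite powRM ?(ltW b0) ?(ltW z0)// mulrA -powR_mulrn ?(ltW b0)//.
  rewrite -powRD; last by rewrite (gt_eqF b0) implybT.
  by rewrite subrr powRr0 mul1r.
have mr := measurable_right_mul a b.
have mrD : measurable (right_mul a b @^-1` (@Gn_val R n @` A)).
  by rewrite -[X in measurable X]setTI; exact: mr.
rewrite ge0_integralZl_EFin//; last 3 first.
- by move=> z _; rewrite lee_fin density_ge0.
- apply: measurable_funTS; apply/measurable_EFinP.
  exact: (measurableT_comp md mr).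
- by rewrite exprn_ge0 ?ltW.
transitivity ((b ^+ n.+1)%:E *
    \int[image_measure leb mr]_(z in @Gn_val R n @` A) (density z)%:E).
  rewrite ge0_integral_pushforward//.
  - by apply: measurable_funTS; exact/measurable_EFinP.
  - by move=> z _; rewrite lee_fin density_ge0.
have bV0 : (0 <= b^-1)%R by rewrite invr_ge0 ltW.
transitivity ((b ^+ n.+1)%:E *
    \int[mscale (NngNum bV0) leb]_(z in @Gn_val R n @` A) (density z)%:E).
  congr (_ * _); apply: eq_measure_integral => B mB _.
  exact: lebesgue_right_mul.
rewrite ge0_integral_mscale//; last 2 first.
- by apply: measurable_funTS; exact/measurable_EFinP.
- by move=> z _; rewrite lee_fin density_ge0.
by rewrite muleA -EFinM exprSr mulfK// gt_eqF.
Qed.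

Lemma haar_integral_mulr (h : G) (f : G -> \bar R) :
  measurable_fun setT f -> (forall g, 0 <= f g) ->
  \int[haar R n]_g f (Gn_mul g h) = (Gy h ^+ n)%:E * \int[haar R n]_g f g.
Proof.
move=> mf f0.
transitivity (\int[image_measure (haar R n) (measurable_mulr h)]_g f g).
  by rewrite ge0_integral_pushforward//; exact: measurable_mulr.
have b0 : (0 <= Gy h ^+ n)%R by rewrite exprn_ge0// ltW// Gy_gt0.
transitivity (\int[mscale (NngNum b0) (haar R n)]_g f g).
  by apply: eq_measure_integral => A mA _; exact: haar_mulr.
by rewrite ge0_integral_mscale.
Qed.

End haar_measure.

(** * Boxes and sigma-finiteness *)

Section boxes.
Context (R : realType) (n : nat).
Local Notation G := (Gn R n).
Local Notation leb := (lebesgue_rV R n \x lebesgue_measure).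

(** The boxes exhaust the group and are comparable with products of intervals; a
    single parameter is enough for all the estimates, which only need to be
    exponential in the number of steps. *)
Definition box (Y : R) : set G :=
  [set g | (forall i, `|Gx g ord0 i| <= Y)%R /\ (Y^-1 <= Gy g <= Y)%R].

Lemma measurable_box Y : measurable (box Y).
Proof.
rewrite (_ : box Y =
    (@Gx R n @^-1` \bigcap_(i in [set: 'I_n])
       ((fun x : 'rV[R]_n => x ord0 i) @^-1` [set` `[(- Y)%R, Y]%R])) `&`
    (@Gy R n @^-1` [set` `[Y^-1%R, Y]%R])).
  apply: measurableI; rewrite -[X in measurable X]setTI.
    apply: measurable_Gx => //; apply: fin_bigcap_measurable => // i _.
    by rewrite -[X in measurable X]setTI; exact: measurable_coord.
  exact: measurable_Gy.
apply/seteqP; split => g /=.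
  move=> [gx gy]; split; last by rewrite in_itv.
  by move=> i _ /=; rewrite in_itv /= -ler_norml.
move=> [gx gy]; split; last by move: gy; rewrite in_itv.
by move=> i; have := gx i I; rewrite /= in_itv /= -ler_norml.
Qed.

Lemma leb_box (Y : R) : (1 <= Y)%R ->
  leb (@Gn_val R n @` box Y) = ((Y *+ 2) ^+ n * (Y - Y^-1))%:E.
Proof.
move=> Y1; have Y0 : (0 < Y)%R by exact: lt_le_trans Y1.
have -> : @Gn_val R n @` box Y =
    [set x : 'rV[R]_n | forall i : 'I_n, [set` `[(- Y)%R, Y]%R] (x ord0 i)] `*`
    [set` `[Y^-1%R, Y]%R].
  apply/seteqP; split => z /=.
    move=> [g [gx gy] <-] /=; split; last by rewrite in_itv.
    by move=> i; rewrite in_itv /= -ler_norml.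
  move=> [zx]; rewrite in_itv /= => zy.
  have z0 : (0 < (z.2 : R))%R.
    by case/andP: zy => + _; apply: lt_le_trans; rewrite invr_gt0.
  exists (MkGn z.1 z0); last by rewrite /Gn_val /= -surjective_pairing.
  by split => //= i; have := zx i; rewrite in_itv /= -ler_norml.
rewrite product_measure1E//; last first.
  rewrite (_ : mkset _ = \bigcap_(i in [set: 'I_n])
     ((fun x : 'rV[R]_n => x ord0 i) @^-1` [set` `[(- Y)%R, Y]%R])).
    apply: fin_bigcap_measurable => // i _.
    by rewrite -[X in measurable X]setTI; exact: measurable_coord.
  by apply/seteqP; split => [x /= H i _|x /= H i]; [exact: H|exact: (H i I)].
transitivity ((\prod_(i < n) lebesgue_measure [set` `[(- Y)%R, Y]%R]) *
    lebesgue_measure [set` `[Y^-1%R, Y]%R]).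
  congr (_ * _); exact: (@lebesgue_rV_box R n (fun=> [set` `[(- Y)%R, Y]%R])
    (fun=> measurable_itv _)).
rewrite !lebesgue_measure_itv/= !lte_fin gtrN//.
have -> : \prod_(i < n) (Y%:E - (- Y)%:E) = ((Y *+ 2) ^+ n)%:E.
  rewrite -EFinB opprK -mulr2n.
  by rewrite prodEFin prodr_const card_ord.
rewrite EFinM; congr (_ * _).
case: ltP => // YY; apply/eqP; rewrite eq_sym eqe subr_eq0 eq_le YY /=.
by rewrite (le_trans _ Y1)// invf_le1.
Qed.

(** The density is at most [Y^(n+1)] on the box, whose Lebesgue measure is at most
    [(2 * Y)^n * Y]. *)
Lemma haar_box_le (Y : R) : (1 <= Y)%R ->
  haar R n (box Y) <= (2 ^+ n * Y ^+ (n.+1).*2)%:E.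
Proof.
move=> Y1; have Y0 : (0 < Y)%R by exact: lt_le_trans Y1.
rewrite haarE.
have mD : measurable (@Gn_val R n @` box Y).
  by apply: measurable_image_Gn_val; exact: measurable_box.
apply: (@le_trans _ _ (\int[leb]_(z in @Gn_val R n @` box Y) (Y ^+ n.+1)%:E)).
  apply: le_ge0_integral => z; first by rewrite lee_fin density_ge0.
  move=> /[dup] /image_Gn_val_gt0 z0 [g [_ /andP[gy _]]] gz.
  have zy : (Y^-1 <= (z.2 : R))%R by rewrite -gz.
  rewrite densityE// lee_fin -exprVn lerXn2r ?nnegrE ?invr_ge0 ?(ltW Y0) ?(ltW z0)//.
  by rewrite invf_ple.
rewrite integral_cst// [X in _ * X](leb_box Y1) -EFinM lee_fin.
have YV : (0 <= Y^-1)%R by rewrite invr_ge0 ltW.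
rewrite -addnn exprD -(mulr_natr Y) exprMn.
have key : (Y ^+ n * (Y - Y^-1) <= Y ^+ n.+1)%R.
  by rewrite exprSr ler_pM2l ?exprn_gt0// gerBl.
have := ler_wpM2l (mulr_ge0 (exprn_ge0 n (ler0n R 2)) (exprn_ge0 n.+1 (ltW Y0))) key.
move=> H; rewrite [leRHS]mulrA; apply: (le_trans _ H).
by rewrite le_eqVlt; apply/predU1P; left; ring.
Qed.

Lemma haar_box_gt0 : 0 < haar R n (box 2).
Proof.
rewrite haarE.
have mD : measurable (@Gn_val R n @` box 2).
  by apply: measurable_image_Gn_val; exact: measurable_box.
apply: (@lt_le_trans _ _ (\int[leb]_(z in @Gn_val R n @` box 2) (2 ^- n.+1)%:E)).
  rewrite integral_cst// [X in _ * X](leb_box (ler1n R 2)) -EFinM lte_fin.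
  rewrite mulr_gt0 ?invr_gt0 ?exprn_gt0// mulr_gt0 ?exprn_gt0 ?pmulrn_lgt0//.
  lra.
apply: le_ge0_integral => z; first by rewrite lee_fin invr_ge0 exprn_ge0.
move=> /[dup] /image_Gn_val_gt0 z0 [g [_ /andP[_ gy]]] gz.
have zy : ((z.2 : R) <= 2)%R by rewrite -gz.
rewrite densityE// lee_fin -!exprVn lerXn2r ?nnegrE ?invr_ge0 ?(ltW z0)//.
by rewrite lef_pV2 ?posrE.
Qed.

Lemma haar_box_lty (Y : R) : (1 <= Y)%R -> haar R n (box Y) < +oo.
Proof. by move=> Y1; rewrite (le_lt_trans (haar_box_le Y1))// ltry. Qed.

Lemma haar_sigma_finite : sigma_finite setT (haar R n).
Proof.
exists (fun k => box k.+1%:R); last first.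
  by move=> k; split; [exact: measurable_box|rewrite haar_box_lty// ler1n].
apply/seteqP; split => // g _.
pose m := Num.max (\sum_i `|Gx g ord0 i|)%R (Num.max (Gy g) (Gy g)^-1)%R.
have [k mk] : exists k : nat, (m <= k.+1%:R)%R.
  by exists (Num.truncn m); rewrite ltW// truncnS_gt.
move: mk; rewrite !ge_max => /and3P[xk yk Vk].
exists k => //; split.
  move=> i; apply: le_trans xk; rewrite (bigD1 i)//= lerDl.
  by rewrite sumr_ge0.
by rewrite yk andbT invf_ple// posrE// Gy_gt0.
Qed.

HB.instance Definition _ := Measure_isSigmaFinite.Build _ _ _ (haar R n)
  haar_sigma_finite.

End boxes.

(** * The convolution operator *)

Section operator.
Context (R : realType) (n : nat).
Local Notation G := (Gn R n).
Context (sigma : probability G R).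
Local Notation T := (R_op sigma).
Local Notation mu := (haar R n).

Lemma R_op_ge0 (f : G -> \bar R) : (forall g, 0 <= f g) ->
  forall g, 0 <= T f g.
Proof. by move=> f0 g; apply: integral_ge0. Qed.

Lemma le_R_op (f1 f2 : G -> \bar R) : (forall g, 0 <= f1 g) ->
  (forall g, f1 g <= f2 g) -> forall g, T f1 g <= T f2 g.
Proof. by move=> f0 f12 g; apply: le_ge0_integral. Qed.

Lemma iter_R_op_ge0 (f : G -> \bar R) k : (forall g, 0 <= f g) ->
  forall g, 0 <= iter k T f g.
Proof. by move=> f0; elim: k => [//|k IH]; exact: R_op_ge0. Qed.

Lemma abse_iter_R_op (f : G -> \bar R) k g :
  `|iter k T f g| <= iter k T (fun x => `|f x|) g.
Proof.
elim: k g => [//|k IH] g /=.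
apply: (le_trans (abse_integral_le _ _)).
exact: (le_R_op (fun=> abse_ge0 _)).
Qed.

Lemma measurable_R_op (f : G -> \bar R) : measurable_fun setT f ->
  (forall g, 0 <= f g) -> measurable_fun setT (T f).
Proof.
move=> mf f0.
have mF : measurable_fun setT (fun z : G * G => f (Gn_mul z.1 z.2)).
  exact: (measurableT_comp mf (@measurable_Gn_mul R n)).
exact: (measurable_fun_fubini_tonelli_F (m2 := sigma) _ mF (fun=> f0 _)).
Qed.

Lemma measurable_iter_R_op (f : G -> \bar R) k : measurable_fun setT f ->
  (forall g, 0 <= f g) -> measurable_fun setT (iter k T f).
Proof.
move=> mf f0; elim: k => [//|k IH]; apply: measurable_R_op => //.
exact: iter_R_op_ge0.
Qed.

(** Tonelli: for fixed [h], integrating the translate [f (g h)] in [g] produces the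
    factor [Gy h ^+ n]. *)
Lemma integral_weighted_R_op (v : G -> R) (f : G -> \bar R) :
  measurable_fun setT v -> (forall h, 0 <= v h)%R ->
  measurable_fun setT f -> (forall g, 0 <= f g) ->
  \int[mu]_g \int[sigma]_h ((v h)%:E * f (Gn_mul g h)) =
  \int[sigma]_h (v h * Gy h ^+ n)%:E * \int[mu]_g f g.
Proof.
move=> mv v0 mf f0.
pose F (z : G * G) := (v z.2)%:E * f (Gn_mul z.1 z.2).
have mF : measurable_fun setT F.
  apply: emeasurable_funM.
    by apply/measurable_EFinP; exact: (measurableT_comp mv measurable_snd).
  exact: (measurableT_comp mf (@measurable_Gn_mul R n)).
have F0 z : 0 <= F z by rewrite mule_ge0// lee_fin.
rewrite (fubini_tonelli (m1 := mu) (m2 := sigma) _ mF F0) /F /=.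
have b0 (h : G) : (0 <= Gy h ^+ n)%R by rewrite exprn_ge0// ltW// Gy_gt0.
transitivity (\int[sigma]_h ((v h * Gy h ^+ n)%:E * \int[mu]_g f g)).
  apply: eq_integral => h _.
  rewrite ge0_integralZl_EFin//; last first.
    exact: (measurableT_comp mf (measurable_mulr h)).
  by rewrite haar_integral_mulr// muleA EFinM.
rewrite ge0_integralZr//.
- apply/measurable_EFinP; apply: measurable_funM => //.
  by apply: measurable_funX; exact: measurable_Gy.
- by move=> h _; rewrite lee_fin mulr_ge0.
- exact: integral_ge0.
Qed.

Lemma rho_gt0 p : 0 < rho sigma p.
Proof.
have m0 : measurable_fun setT (fun h : G => (Gy h `^ (n%:R / p))%:E).
  apply/measurable_EFinP.
  apply: (@measurableT_comp _ _ _ _ _ _ (@powR R ^~ (n%:R / p)%R)) => //.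
  exact: measurable_Gy.
rewrite lt0e integral_ge0 ?andbT; last by move=> h _; rewrite lee_fin powR_ge0.
apply/eqP => H.
have : \int[sigma]_h `|(Gy h `^ (n%:R / p))%:E| = 0.
  rewrite -[RHS]H; apply: eq_integral => h _.
  by rewrite gee0_abs// lee_fin powR_ge0.
move/(ae_eq_integral_abs sigma measurableT m0) => [N [mN N0 sN]].
suff NT : N = setT.
  have /eqP : 1 = 0 :> \bar R by rewrite -(probability_setT sigma) -NT; exact: N0.
  by rewrite onee_eq0.
apply/seteqP; split => // h _; apply: sN => /= /(_ I) [] /eqP.
by rewrite powR_eq0 (gt_eqF (Gy_gt0 h)).
Qed.

Section Lp.
Variables (p r : R).
Hypothesis p1 : (1 <= p)%R.
Hypothesis rhoE : rho sigma p = r%:E.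

Let p0 : (0 < p)%R. Proof. exact: lt_le_trans p1. Qed.

Lemma rho_fin_gt0 : (0 < r)%R.
Proof. by rewrite -lte_fin -rhoE rho_gt0. Qed.
Let r0 := rho_fin_gt0.

(** [T] has norm at most [rho] on [L^p]. Jensen is used with the weight
    [w h = Gy h `^ (n / p)], whose total mass is [rho]; after integration the
    translate of [f `^ p] by [h] produces [Gy h ^+ n = w h `^ p], which turns
    [w `^ (1 - p)] back into [w]. *)
Lemma integral_R_op_powR (f : G -> \bar R) : measurable_fun setT f ->
  (forall g, 0 <= f g) ->
  \int[mu]_g (T f g `^ p) <= (r `^ p)%:E * \int[mu]_g (f g `^ p).
Proof.
move=> mf f0.
pose w (h : G) := (Gy h `^ (n%:R / p))%R.
have w0 h : (0 < w h)%R by rewrite powR_gt0// Gy_gt0.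
have mw : measurable_fun setT w.
  apply: (@measurableT_comp _ _ _ _ _ _ (@powR R ^~ (n%:R / p)%R)) => //.
  exact: measurable_Gy.
have mwp : measurable_fun setT (fun h => w h `^ (1 - p))%R.
  exact: (@measurableT_comp _ _ _ _ _ _ (@powR R ^~ (1 - p)%R)).
have mfp : measurable_fun setT (fun g => f g `^ p).
  exact: (measurableT_comp (measurable_poweR p)).
have fp0 g : 0 <= f g `^ p by exact: poweR_ge0.
pose J g := \int[sigma]_h ((w h `^ (1 - p))%:E * f (Gn_mul g h) `^ p).
have mJ : measurable_fun setT J.
  have mF : measurable_fun setT
      (fun z : G * G => (w z.2 `^ (1 - p))%:E * f (Gn_mul z.1 z.2) `^ p).
    apply: emeasurable_funM.
      by apply/measurable_EFinP; exact: (measurableT_comp mwp measurable_snd).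
    exact: (measurableT_comp mfp (@measurable_Gn_mul R n)).
  apply: (measurable_fun_fubini_tonelli_F (m2 := sigma) _ mF) => z.
  by rewrite mule_ge0// lee_fin powR_ge0.
have J0 g : 0 <= J g.
  by apply: integral_ge0 => h _; rewrite mule_ge0// lee_fin powR_ge0.
apply: (@le_trans _ _ (\int[mu]_g ((r `^ (p - 1))%:E * J g))).
  apply: le_ge0_integral => g _; first exact: poweR_ge0.
  apply: (weighted_jensen p1 w0 mw r0) => //.
  exact: (measurableT_comp mf (measurable_mull g)).
rewrite ge0_integralZl_EFin//; last exact: powR_ge0.
rewrite [X in _ * X](integral_weighted_R_op mwp (fun=> powR_ge0 _ _) mfp fp0).
rewrite muleA.
have -> : \int[sigma]_h (w h `^ (1 - p) * Gy h ^+ n)%:E = r%:E.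
  rewrite -rhoE; apply: eq_integral => h _; congr EFin.
  have -> : (Gy h ^+ n = w h `^ p)%R.
    by rewrite /w -powRrM divfK ?gt_eqF// powR_mulrn// ltW// Gy_gt0.
  rewrite -powRD; last by rewrite (gt_eqF (w0 h)) implybT.
  by rewrite subrK powRr1// ltW.
by rewrite -EFinM mulrC mulr_powRB1// ltW.
Qed.

Lemma integral_iter_R_op_powR (f : G -> \bar R) k : measurable_fun setT f ->
  (forall g, 0 <= f g) ->
  \int[mu]_g (iter k T f g `^ p) <= ((r `^ p) ^+ k)%:E * \int[mu]_g (f g `^ p).
Proof.
move=> mf f0; elim: k => [|k IH]; first by rewrite expr0 mul1e.
rewrite iterS exprS EFinM -muleA.
apply: le_trans (lee_wpmul2l _ IH); last by rewrite lee_fin powR_ge0.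
apply: integral_R_op_powR; last exact: iter_R_op_ge0.
exact: measurable_iter_R_op.
Qed.

End Lp.

(** On nonnegative functions the [L^1] bound is an equality. *)
Lemma integral_R_op (f : G -> \bar R) : measurable_fun setT f ->
  (forall g, 0 <= f g) ->
  \int[mu]_g T f g = rho sigma 1 * \int[mu]_g f g.
Proof.
move=> mf f0.
transitivity (\int[mu]_g \int[sigma]_h (1%:E * f (Gn_mul g h))).
  by apply: eq_integral => g _; apply: eq_integral => h _; rewrite mul1e.
rewrite (integral_weighted_R_op (v := fun=> 1%R))//.
congr (_ * _); apply: eq_integral => h _; congr EFin.
by rewrite mul1r divr1 powR_mulrn// ltW// Gy_gt0.
Qed.

Lemma integral_iter_R_op_ge (f : G -> \bar R) (r : R) k : (0 <= r)%R ->
  r%:E <= rho sigma 1 -> measurable_fun setT f -> (forall g, 0 <= f g) ->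
  (r ^+ k)%:E * \int[mu]_g f g <= \int[mu]_g iter k T f g.
Proof.
move=> r0 rr mf f0; elim: k => [|k IH]; first by rewrite expr0 mul1e.
rewrite iterS integral_R_op; last 2 first.
- exact: measurable_iter_R_op.
- exact: iter_R_op_ge0.
rewrite exprS EFinM -muleA lee_pmul//.
by rewrite mule_ge0// ?lee_fin ?exprn_ge0//; exact: integral_ge0.
Qed.

End operator.

(** * Boundedness of the maximal function *)

Lemma nneseries_geometric (R : realType) (r : R) : (0 <= r)%R -> (r < 1)%R ->
  \sum_(k <oo) (r ^+ k)%:E = ((1 - r)^-1)%:E.
Proof.
move=> r0 r1; apply/cvg_lim => //.
have /cvg_geometric_series : (`|r| < 1)%R by rewrite ger0_norm.
move=> /(_ 1%R) H.
rewrite (_ : (fun _ => _) = EFin \o series (geometric 1%R r)).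
  by rewrite -div1r; apply: cvg_EFin => //; exact: nearW.
apply/funext => k /=; rewrite /series /= -sumEFin.
by apply: eq_bigr => i _; rewrite mul1r.
Qed.

Section strong_type.
Context (R : realType) (n : nat).
Local Notation G := (Gn R n).
Context (sigma : probability G R).
Local Notation T := (R_op sigma).
Local Notation mu := (haar R n).

Lemma M_op_ge_iter (f : G -> \bar R) N g : (1 <= N)%N ->
  (N%:R^-1)%:E * `|iter N T f g| <= M_op sigma f g.
Proof.
move=> N1.
apply: (@le_trans _ _ (N%:R^-1%:E * (\sum_(1 <= k < N.+1) `|iter k T f g|))).
  rewrite lee_wpmul2l ?lee_fin//.
  by rewrite big_nat_recr//= leeDr// sume_ge0.
by apply: ereal_sup_ubound; exists N.
Qed.

Lemma M_op_ge0 (f : G -> \bar R) g : 0 <= M_op sigma f g.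
Proof.
apply: le_trans (M_op_ge_iter f g (leqnn 1)).
by rewrite mule_ge0// lee_fin.
Qed.

(** Each average is below the sum of its terms, hence below the whole series. *)
Lemma M_op_le_series (f : G -> \bar R) g :
  M_op sigma f g <= \sum_(k <oo) iter k T (fun x => `|f x|) g.
Proof.
have F0 k : 0 <= iter k T (fun x => `|f x|) g.
  by apply: iter_R_op_ge0 => x; exact: abse_ge0.
apply: ge_ereal_sup => _ [N /= N1 <-].
apply: (@le_trans _ _ (\sum_(1 <= k < N.+1) iter k T (fun x => `|f x|) g)).
  apply: (@le_trans _ _ (\sum_(1 <= k < N.+1) `|iter k T f g|)).
    rewrite -[leRHS]mul1e lee_wpmul2r ?sume_ge0// lee_fin.
    by rewrite invf_le1 ?ler1n// ltr0n.
  by apply: lee_sum => k _; exact: abse_iter_R_op.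
apply: (le_trans _ (nneseries_lim_ge N.+1 _)) => //.
by rewrite [leRHS]big_ltn// leeDr.
Qed.

(** Minkowski's inequality for the series, proved as one more instance of Jensen:
    the measure is the counting measure on [nat] and the weight is [r ^+ k], of
    total mass [1 / (1 - r)]. The factor [(r ^+ k) `^ (1 - p)] that it costs is
    compensated by the bound [(r `^ p) ^+ k] on the [k]-th iterate. *)
Lemma integral_series_powR (p r : R) (F : G -> \bar R) : (1 <= p)%R ->
  rho sigma p = r%:E -> (r < 1)%R ->
  measurable_fun setT F -> (forall g, 0 <= F g) ->
  \int[mu]_g ((\sum_(k <oo) iter k T F g) `^ p) <=
  ((1 - r)^-1 `^ p)%:E * \int[mu]_g (F g `^ p).
Proof.
move=> p1 rhoE r1 mF F0.
have p0 : (0 < p)%R by exact: lt_le_trans p1.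
have r0 : (0 < r)%R by exact: rho_fin_gt0 rhoE.
pose W := ((1 - r)^-1)%R.
have I0 : 0 <= \int[mu]_g (F g `^ p).
  by apply: integral_ge0 => g _; exact: poweR_ge0.
have [->|Ify] := eqVneq (\int[mu]_g (F g `^ p)) +oo.
  by rewrite gt0_muley ?leey// lte_fin powR_gt0// invr_gt0 subr_gt0.
have W0 : (0 < W)%R by rewrite invr_gt0 subr_gt0.
have mk k : measurable_fun setT (fun g => iter k T F g `^ p).
  apply: (measurableT_comp (measurable_poweR p)).
  exact: measurable_iter_R_op.
have wk0 k : (0 <= (r ^+ k) `^ (1 - p))%R by exact: powR_ge0.
apply: (@le_trans _ _ (\int[mu]_g ((W `^ (p - 1))%:E *
   \sum_(k <oo) (((r ^+ k) `^ (1 - p))%:E * iter k T F g `^ p)))).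
  apply: le_ge0_integral => g _; first exact: poweR_ge0.
  have c1 k : 0 <= iter k T F g by exact: iter_R_op_ge0.
  have c2 k : 0 <= ((r ^+ k) `^ (1 - p))%:E * iter k T F g `^ p.
    by rewrite mule_ge0 ?lee_fin ?wk0 ?poweR_ge0//.
  rewrite -(ge0_integral_count c1) -(ge0_integral_count c2).
  apply: (weighted_jensen (w := fun k => (r ^+ k)%R)) => //.
  - by move=> k; rewrite exprn_gt0.
  - rewrite ge0_integral_count; first by rewrite nneseries_geometric ?(ltW r0).
    by move=> k; rewrite lee_fin exprn_ge0 ?(ltW r0).
rewrite ge0_integralZl_EFin//; last 3 first.
- move=> g _; apply: nneseries_ge0 => k _ _.
  by rewrite mule_ge0 ?lee_fin ?wk0 ?poweR_ge0.
- apply: ge0_emeasurable_sum => [k g _ _|k _].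
    by rewrite mule_ge0 ?lee_fin ?wk0 ?poweR_ge0.
  exact: measurable_funeM.
- exact: powR_ge0.
rewrite integral_nneseries//; last 2 first.
- by move=> k; exact: measurable_funeM.
- by move=> k g _; rewrite mule_ge0 ?lee_fin ?wk0 ?poweR_ge0//.
rewrite -(mulr_powRB1 (ltW W0) p0) mulrC EFinM -muleA.
rewrite lee_wpmul2l ?lee_fin ?powR_ge0//.
have rk k : ((r ^+ k) `^ (1 - p))%:E *
      (((r `^ p) ^+ k)%:E * \int[mu]_g (F g `^ p)) =
    \int[mu]_g (F g `^ p) * (r ^+ k)%:E.
  rewrite muleA muleC; congr (_ * _); rewrite -EFinM; congr EFin.
  have rk0 : (0 < r ^+ k)%R by rewrite exprn_gt0.
  have -> : ((r `^ p) ^+ k = (r ^+ k) `^ p)%R.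
    by rewrite -!powR_mulrn ?powR_ge0 ?(ltW r0)// -!powRrM mulrC.
  rewrite -powRD; last by rewrite (gt_eqF rk0) implybT.
  by rewrite subrK powRr1// ltW.
have [i iE] : exists i, \int[mu]_g (F g `^ p) = i%:E.
  by exists (fine (\int[mu]_g (F g `^ p))); rewrite fineK// ge0_fin_numE// ltey.
rewrite -/W -nneseries_geometric ?(ltW r0)// muleC iE -nneseriesZl; last first.
  by move=> k _; rewrite lee_fin exprn_ge0 ?(ltW r0).
apply: lee_nneseries => [k _ _|k _].
  apply: integral_ge0 => g _.
  by rewrite mule_ge0 ?lee_fin ?wk0 ?poweR_ge0.
rewrite -iE -rk ge0_integralZl_EFin//; last by move=> g _; exact: poweR_ge0.
rewrite lee_wpmul2l ?lee_fin//.
exact: integral_iter_R_op_powR.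
Qed.



Lemma M_op_strong_type (p : R) : (1 <= p)%R -> rho sigma p < 1 ->
  exists C : R, forall f : G -> R, f \in Lfun mu p%:E ->
    'N[mu]_p%:E[M_op sigma (EFin \o f)] <= C%:E * 'N[mu]_p%:E[EFin \o f].
Proof.
move=> p1 rho1.
have p0 : (0 < p)%R by exact: lt_le_trans p1.
have [r rhoE] : exists r, rho sigma p = r%:E.
  exists (fine (rho sigma p)); rewrite fineK// ge0_fin_numE ?(ltW (rho_gt0 _ _))//.
  exact: lt_trans rho1 (ltry _).
have r1 : (r < 1)%R by rewrite -lte_fin -rhoE.
exists ((1 - r)^-1)%R => f /sub_Lfun_mfun; rewrite inE /= => mf.
pose F g := `|(EFin \o f) g|.
have mF : measurable_fun setT F.
  by apply: measurableT_comp => //; exact/measurable_EFinP.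
have F0 g : 0 <= F g by exact: abse_ge0.
have W0 : (0 <= (1 - r)^-1)%R by rewrite invr_ge0 subr_ge0 ltW.
have := integral_series_powR p1 rhoE r1 mF F0.
have pV0 : (0 <= p^-1)%R by rewrite invr_ge0 ltW.
move=> H; rewrite Lnorm.unlock.
rewrite (_ : ((1 - r)^-1)%:E = (((1 - r)^-1) `^ p)%:E `^ p^-1); last first.
  by rewrite poweR_EFin -powRrM mulfV ?gt_eqF// powRr1.
rewrite -poweRM; last 2 first.
- by rewrite lee_fin powR_ge0.
- by apply: integral_ge0 => g _; exact: poweR_ge0.
apply: gt0_ler_poweR => //.
- by rewrite in_itv /= leey andbT; apply: integral_ge0 => g _; exact: poweR_ge0.
- rewrite in_itv /= leey andbT mule_ge0// ?lee_fin ?powR_ge0//.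
  by apply: integral_ge0 => g _; rewrite lee_fin; exact: powR_ge0.
apply: le_trans H; apply: le_ge0_integral => g _; first exact: poweR_ge0.
apply: gt0_ler_poweR; rewrite ?(ltW p0)//.
- by rewrite in_itv /= leey andbT abse_ge0.
- rewrite in_itv /= leey andbT; apply: nneseries_ge0 => k _ _; exact: iter_R_op_ge0.
- by rewrite gee0_abs ?M_op_ge0//; exact: M_op_le_series.
Qed.

End strong_type.

(** * Supports of the iterates *)

Section support.
Context (R : realType) (n : nat).
Local Notation G := (Gn R n).

(** Pull back from [R^n * R], which is Hausdorff: the coordinate map is continuous
    and injective, so a compact set is the preimage of its compact image. *)
Lemma compact_Gn_closed (K : set G) : compact K -> closed K.
Proof.
move=> cK.
pose val : G -> 'rV[R]_n * R := @Gn_val R n.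
have cval : continuous val by exact: initial_continuous.
have cKi : compact (val @` K).
  by apply: continuous_compact => //; exact: continuous_subspaceT.
have clK : closed (val @` K) by apply: compact_closed => //; exact: norm_hausdorff.
have -> : K = val @^-1` (val @` K).
  apply/seteqP; split => [g Kg|g [h Kh /Gn_val_inj <-]//]; by exists g.
by apply: closed_comp => // g _; exact: cval.
Qed.

Lemma compact_Gn_measurable (K : set G) : compact K -> measurable K.
Proof.
move=> /compact_Gn_closed cK; rewrite -[K]setCK; apply: measurableC.
by apply: sub_sigma_algebra; exact: closed_openC.
Qed.

(** The inverse of the height is bounded on a compact set too, being continuous on
    the group. *)
Lemma compact_Gn_sub_box (K : set G) : compact K ->
  exists2 c : R, (1 <= c)%R & K `<=` box c.
Proof.
move=> cK.
have bounded (V : normedModType R) (f : G -> V) : continuous f ->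
    exists M : R, forall g, K g -> (`|f g| <= M)%R.
  move=> cf; have /compact_bounded [M [_ HM]] : compact (f @` K).
    by apply: continuous_compact => //; exact: continuous_subspaceT.
  exists (M + 1)%R => g Kg; apply: (HM (M + 1)%R); first by rewrite ltrDl.
  by exists g.
have [Mx Hx] := bounded _ _ (@Gx_continuous R n).
have [My Hy] := bounded _ _ (@Gy_continuous R n : continuous (@Gy R n : G -> R^o)).
have cV : continuous (fun g : G => (Gy g)^-1%R : R^o).
  move=> g; apply: cvgV; first exact: nbhs_filter.
    by apply: lt0r_neq0; exact: Gy_gt0.
  exact: Gy_continuous.
have [Mv Hv] := bounded _ _ cV.
exists (Num.max 1 (Num.max Mx (Num.max My Mv)))%R; first by rewrite le_max lexx.
set c := Num.max _ _.
have c0 : (0 < c)%R by rewrite lt_max ltr01.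
move=> g Kg; have g0 := Gy_gt0 g; split => [i|].
  rewrite !le_max; apply/orP; right; apply/orP; left.
  apply: le_trans (Hx _ Kg); rewrite [leRHS]/Num.Def.normr /= mx_normrE.
  by apply/bigmax_geP; right => /=; exists (ord0, i).
apply/andP; split.
  rewrite invf_ple ?posrE// !le_max; apply/orP; right; apply/orP; right.
  by apply/orP; right; apply: le_trans (Hv _ Kg); rewrite ger0_norm// invr_ge0 ltW.
rewrite !le_max; apply/orP; right; apply/orP; right.
by apply/orP; left; apply: le_trans (Hy _ Kg); rewrite ger0_norm// ltW.
Qed.

(** With [g = (x, y)] and [h = (a, b)], the height is [y = (y b) b^-1] and the
    position is [x = (x + y a) - y a]: the former changes by a factor at most [c],
    the latter by at most [Y c^2]. *)
Lemma box_mulr (c Y : R) (g h : G) : (1 <= c)%R -> (1 <= Y)%R ->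
  box c h -> box Y (Gn_mul g h) -> box (2 * c ^+ 2 * Y) g.
Proof.
move=> c1 Y1 [hx /andP[hy1 hy2]] [/= gx /andP[gy1 gy2]].
have c0 : (0 < c)%R by exact: lt_le_trans c1.
have Y0 : (0 < Y)%R by exact: lt_le_trans Y1.
have g0 := Gy_gt0 g; have h0 := Gy_gt0 h.
have yc : (Gy g <= Y * c)%R.
  have -> : (Gy g = Gy g * Gy h * (Gy h)^-1)%R by rewrite mulfK// gt_eqF.
  rewrite ler_pM ?(ltW (mulr_gt0 _ _)) ?invr_ge0 ?(ltW h0)//.
  by rewrite invf_ple.
have yV : ((Gy g)^-1 <= Y * c)%R.
  have -> : ((Gy g)^-1 = (Gy g * Gy h)^-1 * Gy h)%R.
    by rewrite invfM divfK// gt_eqF.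
  rewrite ler_pM ?invr_ge0 ?(ltW (mulr_gt0 _ _)) ?(ltW h0)//.
  by rewrite invf_ple ?posrE// mulr_gt0.
have ccc : (Y * c <= 2 * c ^+ 2 * Y)%R by nra.
split => [i|]; last first.
  rewrite (le_trans yc)// andbT invf_ple ?posrE ?(le_trans yV)//.
  by rewrite !mulr_gt0 ?exprn_gt0.
have -> : (Gx g ord0 i = (Gx g + Gy g *: Gx h) ord0 i - Gy g * Gx h ord0 i)%R.
  by rewrite !mxE addrK.
rewrite (le_trans (ler_normB _ _))// normrM (gtr0_norm g0).
have : (Gy g * `|Gx h ord0 i| <= Y * c * c)%R by rewrite ler_pM ?(ltW g0).
by have := gx i; nra.
Qed.

Context (sigma : probability G R).
Local Notation T := (R_op sigma).

Lemma compactly_supported_box : compactly_supported sigma ->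
  exists2 c : R, (1 <= c)%R & sigma (~` box c) = 0.
Proof.
move=> [K [cK sK]]; have [c c1 Kc] := compact_Gn_sub_box cK.
exists c => //; apply/eqP; rewrite -measure_le0 -[leRHS]sK.
apply: le_measure; rewrite ?inE; last exact: subsetC.
- by apply: measurableC; exact: measurable_box.
- by apply: measurableC; exact: compact_Gn_measurable.
Qed.

(** If [g] is outside the larger box then [f (g h) = 0] for all [h] in the box that
    carries [sigma]. *)
Lemma R_op_support (c Y : R) (f : G -> \bar R) : (1 <= c)%R -> (1 <= Y)%R ->
  sigma (~` box c) = 0 -> measurable_fun setT f -> (forall g, 0 <= f g) ->
  (forall g, ~ box Y g -> f g = 0) ->
  forall g, ~ box (2 * c ^+ 2 * Y) g -> T f g = 0.
Proof.
move=> c1 Y1 sc mf f0 fY g gY.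
rewrite /R_op (ge0_ae_eq_integral _ _ (measurable_cst 0))//.
- by rewrite integral0.
- exact: (measurableT_comp mf (measurable_mull g)).
- exists (~` box c); split => //.
    by apply: measurableC; exact: measurable_box.
  move=> h /= fh ch; apply: fh => _; apply: fY => gh; apply: gY.
  exact: box_mulr ch gh.
Qed.

Lemma iter_R_op_support (c Y : R) (f : G -> \bar R) k : (1 <= c)%R -> (1 <= Y)%R ->
  sigma (~` box c) = 0 -> measurable_fun setT f -> (forall g, 0 <= f g) ->
  (forall g, ~ box Y g -> f g = 0) ->
  forall g, ~ box ((2 * c ^+ 2) ^+ k * Y) g -> iter k T f g = 0.
Proof.
move=> c1 Y1 sc mf f0 fY; elim: k => [|k IH]; first by rewrite expr0 mul1r.
rewrite exprS -mulrA; apply: R_op_support => //.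
- by rewrite mulr_ege1// exprn_ege1// mulr_ege1// ?ler1n// exprn_ege1.
- exact: measurable_iter_R_op.
- exact: iter_R_op_ge0.
Qed.

Lemma iter_R_op_le1 (f : G -> \bar R) k : (forall g, 0 <= f g) ->
  (forall g, f g <= 1) -> forall g, iter k T f g <= 1.
Proof.
move=> f0 f1; elim: k => [//|k IH] g /=.
apply: (@le_trans _ _ (\int[sigma]_h 1)).
  by apply: le_ge0_integral => // h _; exact: iter_R_op_ge0.
by rewrite integral_cst// [X in _ * X](probability_setT sigma) mule1.
Qed.

End support.

(** * Failure of the maximal bounds at exponent 1 *)

(** By Bernoulli [r ^+ m] is at least [m * (r - 1)], so [r ^+ (m * 3)] grows at
    least like a cube. *)
Lemma exponential_beats_quadratic (R : realType) (r i a b : R) :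
  (1 < r)%R -> (0 < i)%R ->
  ~ (forall N : nat, (1 <= N)%N -> (r ^+ N * i <= a * N%:R ^+ 2 + b)%R).
Proof.
move=> r1 i0 H.
pose s := (r - 1)%R.
have s0 : (0 < s)%R by rewrite subr_gt0.
have bernoulli (m : nat) : (m%:R * s <= r ^+ m)%R.
  suff : (1 + m%:R * s <= r ^+ m)%R by apply: le_trans; rewrite lerDr.
  elim: m => [|m IH]; first by rewrite mul0r addr0 expr0.
  have ms : (0 <= m%:R * s)%R by rewrite mulr_ge0// ltW.
  have rE : r = (1 + s)%R by rewrite /s addrC subrK.
  rewrite exprS -natr1 mulrDl mul1r.
  apply: (le_trans _ (ler_wpM2l _ IH)); last by rewrite rE; lra.
  by rewrite rE; nra.
pose K := ((9 * `|a| + `|b|) / (i * s ^+ 3))%R.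
pose m := (Num.truncn K).+1.
have mK : (K < m%:R)%R by exact: truncnS_gt.
have m1 : (1 <= m%:R :> R)%R by rewrite ler1n.
have := H (m * 3)%N erefl.
apply/negP; rewrite -ltNge.
have h1 : ((m%:R * s) ^+ 3 <= r ^+ (m * 3))%R.
  rewrite exprM lerXn2r ?nnegrE ?exprn_ge0 ?mulr_ge0 ?(ltW s0)//.
  by rewrite (le_trans _ (ltW r1)).
have h2 : ((9 * `|a| + `|b|) < m%:R * (i * s ^+ 3))%R.
  by rewrite -ltr_pdivrMr// mulr_gt0// exprn_gt0.
have mm : (1 <= m%:R ^+ 2 :> R)%R by rewrite exprn_ege1.
apply: (@le_lt_trans _ _ ((9 * `|a| + `|b|) * m%:R ^+ 2)%R).
  have -> : (a * (m * 3)%:R ^+ 2 = 9 * a * m%:R ^+ 2 :> R)%R by rewrite natrM; ring.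
  rewrite [leRHS]mulrDl lerD//.
    by rewrite ler_pM2r ?exprn_gt0 ?(lt_le_trans _ m1)// ler_pM2l// ler_norm.
  by rewrite (le_trans (ler_norm b))// ler_peMr.
apply: (@lt_le_trans _ _ ((m%:R * s) ^+ 3 * i)%R); last first.
  by rewrite ler_pM2r.
have -> : ((m%:R * s) ^+ 3 * i = m%:R * (i * s ^+ 3) * m%:R ^+ 2 :> R)%R by ring.
by rewrite ltr_pM2r// exprn_gt0.
Qed.

Section unbounded.
Context (R : realType) (n : nat).
Local Notation G := (Gn R n).
Local Notation mu := (haar R n).

Context (sigma : probability G R).
Local Notation T := (R_op sigma).

Definition indic_box2 : G -> R := \1_(box 2).

Lemma measurable_indic_box2 : measurable_fun setT indic_box2.
Proof. by apply: measurable_indic; exact: measurable_box. Qed.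

Lemma indic_box2_ge0 g : (0 <= indic_box2 g)%R.
Proof. by rewrite /indic_box2 indicE. Qed.

Lemma indic_box2_le1 g : (indic_box2 g <= 1)%R.
Proof. by rewrite /indic_box2 indicE; case: (_ \in _). Qed.

Lemma indic_box2_support g : ~ box 2 g -> indic_box2 g = 0%R.
Proof. by move=> gB; rewrite /indic_box2 indicE memNset. Qed.

Lemma integral_indic_box2 : \int[mu]_g (indic_box2 g)%:E = mu (box 2).
Proof. by rewrite integral_indic ?setIT//; exact: measurable_box. Qed.

Lemma haar_box2_fin : exists2 i : R, (0 < i)%R & mu (box 2) = i%:E.
Proof.
have fin : mu (box 2) \is a fin_num.
  by rewrite ge0_fin_numE ?haar_box_lty ?ler1n// ltW// haar_box_gt0.
by exists (fine (mu (box 2))); rewrite ?fineK// -lte_fin fineK// haar_box_gt0.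
Qed.

Lemma Lnorm1_indic_box2 : 'N[mu]_1[EFin \o indic_box2] = mu (box 2).
Proof.
rewrite Lnorm1 -integral_indic_box2; apply: eq_integral => g _.
by rewrite /= ger0_norm// indic_box2_ge0.
Qed.

Lemma indic_box2_Lfun : indic_box2 \in Lfun mu 1.
Proof.
rewrite inE; apply/andP; split.
  by rewrite inE /=; exact: measurable_indic_box2.
rewrite inE /= /finite_norm Lnorm1_indic_box2.
by have [i _ ->] := haar_box2_fin; exact: ltry.
Qed.

Local Notation F := (EFin \o indic_box2).

Let mF : measurable_fun setT F.
Proof. by apply/measurable_EFinP; exact: measurable_indic_box2. Qed.
Let F0 g : 0 <= F g. Proof. by rewrite lee_fin indic_box2_ge0. Qed.
Let F1 g : F g <= 1. Proof. by rewrite lee_fin indic_box2_le1. Qed.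

Hypothesis rho1 : 1 < rho sigma 1.

Let rho_real : exists2 r : R, (1 < r)%R & r%:E <= rho sigma 1.
Proof.
case: (rho sigma 1) rho1 => [r||//]; first by rewrite lte_fin; exists r.
by move=> _; exists 2%R; rewrite ?leey// ltr1n.
Qed.

(** The [N]-th average already dominates [iter N T indic_box2 / N], whose norm is of
    order [rho ^+ N / N]. *)
Lemma M_op_not_strong_type :
  ~ (exists C : R, forall f : G -> R, f \in Lfun mu 1 ->
     'N[mu]_1[M_op sigma (EFin \o f)] <= C%:E * 'N[mu]_1[EFin \o f]).
Proof.
move=> [C /(_ _ indic_box2_Lfun)].
have [r r1 rr] := rho_real; have [i i0 iE] := haar_box2_fin.
have r0 : (0 <= r)%R by rewrite (le_trans _ (ltW r1)).
rewrite Lnorm1_indic_box2 iE => H.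
(* [C] may be negative *)
apply: (@exponential_beats_quadratic _ r i (`|C| * i) 0 r1 i0) => N N1.
have := integral_iter_R_op_ge N r0 rr mF F0.
rewrite integral_indic_box2 iE => /le_trans IN.
have N0 : (0 < N%:R :> R)%R by rewrite ltr0n.
have : (r ^+ N)%:E * i%:E <= N%:R%:E * (C%:E * i%:E).
  apply: (@le_trans _ _ (N%:R%:E * 'N[mu]_1[M_op sigma F])); last first.
    by rewrite lee_wpmul2l// lee_fin ltW.
  apply: IN.
  rewrite -lee_pdivrMl// Lnorm1 -ge0_integralZl_EFin//; last 2 first.
  - by move=> g _; exact: iter_R_op_ge0.
  - exact: measurable_iter_R_op.
  apply: le_ge0_integral => g _.
    by rewrite mule_ge0 ?lee_fin ?invr_ge0 ?(ltW N0)// iter_R_op_ge0.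
  rewrite gee0_abs ?M_op_ge0// (le_trans _ (M_op_ge_iter _ _ _ N1))//.
  by rewrite gee0_abs// iter_R_op_ge0.
rewrite -!EFinM lee_fin => /le_trans; apply; rewrite addr0.
have N1R : (1 <= N%:R :> R)%R by rewrite ler1n.
have := ler_norm C; have := normr_ge0 C.
move: (`|C|)%R => D D0 CD.
have : (N%:R * (C * i) <= N%:R * (D * i))%R by rewrite ler_pM2l// ler_pM2r.
move/le_trans; apply; rewrite mulrC ler_wpM2l ?mulr_ge0 ?(ltW i0)//.
by rewrite expr2 ler_peMr// ltW.
Qed.

(** The function [f = iter N T indic_box2] is bounded by [1] and lives on a box [S]
    of measure exponential in [N]. A weak type bound for the maximal function
    bounds the measure of [f > t] by a multiple of [N / t], so each dyadic level
    of [f] contributes [O(N)] to its integral. As the measure of [S] is at most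
    exponential, [J = L * N] levels suffice to make what remains on [S] bounded.
    Hence the integral of [f] is [O(N ^+ 2)], whereas it is at least
    [r ^+ N * i]. *)
Lemma M_op_not_weak_type : compactly_supported sigma ->
  ~ (exists C : R, forall f : G -> R, f \in Lfun mu 1 ->
     forall lambda : R, (0 < lambda)%R ->
       mu [set g | lambda%:E < M_op sigma (EFin \o f) g]
         <= (C / lambda)%:E * 'N[mu]_1[EFin \o f]).
Proof.
move=> /compactly_supported_box [c c1 sc] [C /(_ _ indic_box2_Lfun)].
have [r r1 rr] := rho_real; have [i i0 iE] := haar_box2_fin.
have r0 : (0 <= r)%R by rewrite (le_trans _ (ltW r1)).
rewrite Lnorm1_indic_box2 iE => H.
pose D := (2 * c ^+ 2)%R.
have D1 : (1 <= D)%R by rewrite mulr_ege1// ?ler1n// exprn_ege1.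
have D0 : (0 < D)%R by exact: lt_le_trans D1.
(* [2 ^+ L] dominates the growth per step of the Haar measure of the boxes *)
have [L DL] : exists L : nat, (D ^+ (n.+1).*2 <= 2 ^+ L)%R.
  exists (Num.truncn (D ^+ (n.+1).*2)).+1.
  rewrite (le_trans (ltW (truncnS_gt _)))//.
  by rewrite -natrX ler_nat ltnW// ltn_expl.
apply: (@exponential_beats_quadratic _ r i (2 * L%:R * C * i)
  (2 ^+ n * 2 ^+ (n.+1).*2) r1 i0) => N N1.
have N0 : (0 < N%:R :> R)%R by rewrite ltr0n.
pose f g := iter N T F g.
have f0 g : 0 <= f g by exact: iter_R_op_ge0.
have f1 g : f g <= 1 by exact: iter_R_op_le1.
have mf : measurable_fun setT f by exact: measurable_iter_R_op.
pose S : set G := box (D ^+ N * 2).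
have fS g : ~ S g -> f g = 0.
  apply: (@iter_R_op_support _ _ _ _ 2 F) => //; first by rewrite ler1n.
  by move=> h hB; rewrite /= indic_box2_support.
have mS : measurable S by exact: measurable_box.
pose A (j : nat) : set G := [set g | (2^-1 ^+ j.+1)%:E < f g].
have mA j : measurable (A j).
  by rewrite -[A j]setTI; exact: emeasurable_fun_o_infty.
have muA j : mu (A j) <= (C * N%:R * 2 ^+ j.+1 * i)%:E.
  have l0 : (0 < 2^-1 ^+ j.+1 / N%:R :> R)%R by rewrite divr_gt0// exprn_gt0.
  have AM : A j `<=` [set g | (2^-1 ^+ j.+1 / N%:R)%:E < M_op sigma F g].
    move=> g; rewrite /A /= => fg; apply: lt_le_trans (M_op_ge_iter _ _ _ N1).
    by rewrite gee0_abs// -/(f g) mulrC EFinM lte_pmul2l// lte_fin invr_gt0.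
  apply: (le_trans (le_haar AM)); apply: (le_trans (H _ l0)).
  by rewrite -EFinM lee_fin invf_div exprVn invrK mulrA.
pose J := (L * N)%N.
have fle g : f g <= \sum_(j < J) (2^-1 ^+ j)%:E * (\1_(A j) g)%:E +
    (2^-1 ^+ J)%:E * (\1_S g)%:E.
  have rhs0 : 0 <= \sum_(j < J) (2^-1 ^+ j : R)%:E * (\1_(A j) g)%:E.
    by apply: sume_ge0 => j _; rewrite mule_ge0// lee_fin// exprn_ge0.
  have [Sg|Sg] := pselect (S g); last first.
    by rewrite fS// adde_ge0// mule_ge0// lee_fin// exprn_ge0.
  have ffin : f g \is a fin_num.
    by rewrite ge0_fin_numE// (le_lt_trans (f1 g))// ltry.
  have t1 : (fine (f g) <= 1)%R by rewrite -lee_fin fineK.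
  have := dyadic_bound J t1; rewrite -lee_fin fineK// => /le_trans; apply.
  rewrite indicE mem_set// mule1 EFinD leeD2r// -sumEFin.
  apply: lee_sum => j _; rewrite EFinM lee_wpmul2l ?lee_fin ?exprn_ge0//.
  rewrite indicE /A; case: ltP => // fg.
  by rewrite mem_set//= -[f g]fineK// lte_fin.
have mI j : measurable_fun setT (fun g => (\1_(A j) g)%:E : \bar R).
  by apply/measurable_EFinP; exact: measurable_indic.
have mIS : measurable_fun setT (fun g => (\1_S g)%:E : \bar R).
  by apply/measurable_EFinP; exact: measurable_indic.
have e0 j : (0 <= 2^-1 ^+ j :> R)%R by rewrite exprn_ge0.
have intf : \int[mu]_g f g <= \sum_(j < J) (2^-1 ^+ j)%:E * mu (A j) +
    (2^-1 ^+ J)%:E * mu S.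
  apply: (le_trans (le_ge0_integral _ (fun g _ => f0 g) (fun g _ => fle g))).
  have mZ (j : nat) : measurable_fun setT
      (fun g => (2^-1 ^+ j : R)%:E * (\1_(A j) g)%:E).
    exact: measurable_funeM.
  have Z0 (j : nat) g : 0 <= (2^-1 ^+ j : R)%:E * (\1_(A j) g)%:E.
    by rewrite mule_ge0// lee_fin.
  rewrite ge0_integralD//.
  - rewrite ge0_integral_sum//.
    rewrite ge0_integralZl_EFin// integral_indic// setIT leeD2r//.
    apply: lee_sum => j _; rewrite ge0_integralZl_EFin//.
    by rewrite integral_indic// setIT.
  - by move=> g _; apply: sume_ge0.
  - exact: emeasurable_sum.
  - exact: measurable_funeM.
have := integral_iter_R_op_ge N r0 rr mF F0.
rewrite integral_indic_box2 iE -EFinM => IN; rewrite -lee_fin.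
apply: (le_trans IN); apply: (le_trans intf).
rewrite EFinD leeD//.
  apply: (@le_trans _ _ (\sum_(j < J) (2 * C * N%:R * i)%:E)).
    apply: lee_sum => j _; apply: (le_trans (lee_wpmul2l _ (muA j))).
      by rewrite lee_fin.
    rewrite -EFinM lee_fin exprS exprVn.
    have -> : (2 ^- j * (C * N%:R * (2 * 2 ^+ j) * i) =
      2 * C * N%:R * i * (2 ^- j * 2 ^+ j) :> R)%R by ring.
    by rewrite mulVf ?mulr1// expf_neq0// pnatr_eq0.
  rewrite sumEFin sumr_const card_ord lee_fin -[leLHS]mulr_natr /J natrM.
  by rewrite le_eqVlt; apply/predU1P; left; ring.
have S1 : (1 <= D ^+ N * 2)%R by rewrite mulr_ege1 ?exprn_ege1 ?ler1n.
apply: (le_trans (lee_wpmul2l _ (haar_box_le n S1))); first by rewrite lee_fin.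
rewrite -EFinM lee_fin mulrCA ler_pM2l ?exprn_gt0//.
rewrite exprMn mulrA ler_piMl// ?exprn_ge0//.
have E0 : (0 <= D ^+ (n.+1).*2)%R by rewrite exprn_ge0// ltW.
rewrite exprAC /J exprM -exprMn exprn_ile1//; first exact: mulr_ge0.
by rewrite exprVn mulrC ler_pdivrMr ?mul1r// exprn_gt0.
Qed.

End unbounded.

(** * The theorem *)

Theorem theorem4 (R : realType) (n : nat) (n_ge1 : (1 <= n)%N)
    (sigma : probability (Gn R n) R) (csigma : compactly_supported sigma) :
  (forall p : R, (1 <= p)%R -> rho sigma p < 1 ->
     exists C : R, forall f : Gn R n -> R, f \in Lfun (haar R n) p%:E ->
       'N[haar R n]_p%:E[M_op sigma (EFin \o f)]
         <= C%:E * 'N[haar R n]_p%:E[EFin \o f])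
  /\
  (1 < rho sigma 1%R ->
     ~ (exists C : R, forall f : Gn R n -> R, f \in Lfun (haar R n) 1 ->
          'N[haar R n]_1[M_op sigma (EFin \o f)]
            <= C%:E * 'N[haar R n]_1[EFin \o f])
     /\
     ~ (exists C : R, forall f : Gn R n -> R, f \in Lfun (haar R n) 1 ->
          forall lambda : R, (0 < lambda)%R ->
            haar R n [set g | lambda%:E < M_op sigma (EFin \o f) g]
              <= (C / lambda)%:E * 'N[haar R n]_1[EFin \o f])).
Proof.
split=> [p|rho1]; first exact: M_op_strong_type.
by split; [exact: M_op_not_strong_type|exact: M_op_not_weak_type].
Qed.
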